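(* Let $\kappa_0\ge1$ be fixed and assume $\kappa\le\kappa_0$. Let $c_d\ge2$. There is a constant $c_0>0$ such that if $p\ge c_0\frac{\log n}{n}$ and $d\ge c_d np$, then with probability at least $1-O(n^{-5})$, $$\frac{\|\pi-\pi^*\|_2}{\|\pi^*\|_2}\le\frac{C}{\sqrt{npL}},$$ where $C$ depends only on $\kappa_0$ and $c_d$.
   Context: Bradley–Terry–Luce (BTL) setup. There are $n$ items with unknown preference scores $w_1^*\ge w_2^*\ge\cdots\ge w_n^*>0$, all lying in $[w_{\min},w_{\max}]$ with $w_{\min}>0$; set $\theta_i^*=\log w_i^*$ and $\kappa=w_{\max}/w_{\min}$. A comparison graph $\mathcal G=(\{1,\dots,n\},\mathcal E)$ is drawn from the Erdős–Rényi model $\mathcal G_{n,p}$ (each unordered pair is an edge independently with probability $p$). For each edge $(i,j)\in\mathcal E$ one observes $L$ comparisons $y_{i,j}^{(l)}$, $l=1,\dots,L$, where $y_{i,j}^{(l)}=1$ with probability $y^*_{i,j}:=\frac{w_j^*}{w_i^*+w_j^*}$ and $0$ otherwise, with the convention $y_{j,i}^{(l)}=1-y_{i,j}^{(l)}$; all comparisons are mutually independent and independent of $\mathcal G$. Let $y_{i,j}=\frac1L\sum_{l=1}^L y_{i,j}^{(l)}$. Spectral method: for $d>0$ define $P$ by $P_{i,j}=\frac1d y_{i,j}$ if $(i,j)\in\mathcal E$, $P_{i,i}=1-\frac1d\sum_{k:(i,k)\in\mathcal E}y_{i,k}$, and $P_{i,j}=0$ otherwise; $\pi$ is the stationary distribution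 of $P$ (leading left eigenvector normalized to sum to $1$). The normalized score vector is $\pi^*=\frac{1}{\sum_i w_i^*}(w_1^*,\dots,w_n^* )^\top$. *)

(* Defs.v *)
From Stdlib Require Import Reals ClassicalDescription.
From mathcomp Require Import all_boot.

Set Implicit Arguments.
Unset Strict Implicit.
Unset Printing Implicit Defensive.

Local Open Scope R_scope.

Definition rsum (T : finType) (P : pred T) (f : T -> R) : R :=
  \big[Rplus/R0]_(x : T | P x) f x.
Definition rprod (T : finType) (f : T -> R) : R :=
  \big[Rmult/R1]_(x : T) f x.

Definition ind (P : Prop) : R :=
  if excluded_middle_informative P then 1 else 0.

(* Sample space: an outcome consists of the edge indicators (i,j) for i<j
   (the Erdos-Renyi graph) and all comparison outcomes y_{i,j}^{(l)} for i<j,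
   l < L.  Coordinates with ~(i<j) are dummies forced to [false]. *)
Definition Omega (n L : nat) : finType :=
  ({ffun 'I_n * 'I_n -> bool} * {ffun 'I_n * 'I_n * 'I_L -> bool})%type.

Definition ystar n (w : 'I_n -> R) (i j : 'I_n) : R := w j / (w i + w j).

Definition weight n L (p : R) (w : 'I_n -> R) (om : Omega n L) : R :=
  rprod (fun ij : 'I_n * 'I_n =>
     if (ij.1 < ij.2)%N then (if om.1 ij then p else 1 - p)
     else (if om.1 ij then 0 else 1))
  * rprod (fun ijl : 'I_n * 'I_n * 'I_L =>
     let i := ijl.1.1 in let j := ijl.1.2 in
     if (i < j)%N then (if om.2 ijl then ystar w i j else 1 - ystar w i j)
     else (if om.2 ijl then 0 else 1)).

Definition Prob n L (p : R) (w : 'I_n -> R) (E : Omega n L -> Prop) : R :=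
  rsum predT (fun om => weight p w om * ind (E om)).

Definition adj n L (om : Omega n L) (i j : 'I_n) : bool :=
  if (i < j)%N then om.1 (i, j) else if (j < i)%N then om.1 (j, i) else false.

Definition ycmp n L (om : Omega n L) (i j : 'I_n) (l : 'I_L) : R :=
  if (i < j)%N then (if om.2 (i, j, l) then 1 else 0)
  else if (j < i)%N then (if om.2 (j, i, l) then 0 else 1)
  else 0.

Definition yavg n L (om : Omega n L) (i j : 'I_n) : R :=
  / INR L * rsum predT (fun l => ycmp om i j l).

Definition Pmat n L (om : Omega n L) (d : R) (i j : 'I_n) : R :=
  if i == j then 1 - / d * rsum (fun k => adj om i k) (fun k => yavg om i k)
  else if adj om i j then / d * yavg om i j else 0.

Definition stationary n L (om : Omega n L) (d : R) (pi : 'I_n -> R) : Prop :=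
  (forall j, rsum predT (fun i => pi i * Pmat om d i j) = pi j) /\
  rsum predT pi = 1.

Definition pistar n (w : 'I_n -> R) (i : 'I_n) : R := w i / rsum predT w.

Definition norm2 n (v : 'I_n -> R) : R := sqrt (rsum predT (fun i => v i ^ 2)).

(* Main.v *)
(* The stationarity equations do not involve [d]: they say that [pi] balances the
   flows [pi_i y_ij] and [pi_j y_ji] along the edges.  Write [u] for the normalized
   scores, [pi = u (1 + f)], and let [b_j] be the defect of [u] in the j-th equation.
   Testing the equations against [f] gives
     1/2 sum_ij A_ij u_i y_ij (f_i - f_j)^2 = sum_j f_j b_j + 1/2 sum_j f_j^2 b_j,
   and since [y_ij + y_ji = 1] the left-hand side is at least [min u / 2] times the
   Dirichlet form of the unweighted graph: no matrix concentration is needed.  Three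
   facts remain, each valid outside an event of probability O(n^-5):
   - the graph has a spectral gap of order np, by Cheeger's inequality and a union
     bound over all cuts;
   - [max_j |b_j|] is a small multiple of [np max u];
   - [sum_j b_j^2 = O(n np / L) (max u)^2].
   Given a graph with degrees at most 3np, every linear form [sum_j m_j b_j] is
   sub-Gaussian, which gives the second fact, and also the third once [exp (x^2 / 4)]
   is bounded by a mixture of exponentials [exp (m x)] over integers m.  The failure
   event is dominated pointwise by a sum of exponentials, whose mean is computed. *)

Require Import Defs.
From Stdlib Require Import Reals.
From mathcomp Require Import all_boot all_order all_algebra.
From mathcomp Require Import Rstruct.
From mathcomp Require Import ring lra.
Import Order.TTheory GRing.Theory Num.Theory.

Set Implicit Arguments.
Unset Strict Implicit.
Unset Printing Implicit Defensive.

(* [exp] and the lemmas about [R] would otherwise parse their arguments in [R_scope]. *)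
#[local] Bind Scope ring_scope with R.
#[local] Arguments exp : clear scopes.

(** * Cheeger's inequality and stability of the balance equations *)

Section Cheeger.
Local Open Scope ring_scope.

Variables (F : realFieldType) (T : finType) (A : T -> T -> F).
Hypothesis A_ge0 : forall i j, 0 <= A i j.
Hypothesis A_sym : forall i j, A i j = A j i.

(** Each crossing edge is counted once, oriented out of [S], whereas sums over ordered pairs see it
    twice. *)
Definition cut (S : {set T}) : F :=
  \sum_i \sum_j A i j * ((i \in S)%:R * (j \notin S)%:R).

Lemma sum_abs_indicator (S : {set T}) :
  \sum_i \sum_j A i j * `|(i \in S)%:R - (j \in S)%:R| = 2 * cut S.
Proof.
have -> : 2 * cut S = cut S + \sum_i \sum_j A i j * ((j \in S)%:R * (i \notin S)%:R).
  rewrite exchange_big /= mulr_natl mulr2n; congr (_ + _).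
  by apply: eq_bigr => i _; apply: eq_bigr => j _; rewrite A_sym.
rewrite -big_split; apply: eq_bigr => i _; rewrite -big_split; apply: eq_bigr => j _.
by case: (i \in S); case: (j \in S) => /=;
  rewrite ?subrr ?subr0 ?sub0r ?normrN ?normr1 ?normr0 /=; ring.
Qed.

(* Level-set induction: subtracting the least positive value of [g] from [g] on
   its support shrinks the support, and the cut of the support pays for it. *)
Lemma expansion_l1 (h : F) (g : T -> F) :
  (forall S : {set T}, (2 * #|S| <= #|T|)%N -> h * #|S|%:R <= cut S) ->
  (forall i, 0 <= g i) -> (2 * #|[set i | g i != 0%R]| <= #|T|)%N ->
  2 * h * \sum_i g i <= \sum_i \sum_j A i j * `|g i - g j|.
Proof.
move=> hcut; have [k] := ubnP #|[set i | g i != 0]|.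
elim: k g => // k IH g ltk g_ge0 supp.
have [/eqP S0|/set0Pn[i1 i1S]] := boolP ([set i | g i != 0%R] == set0).
  have g0 i : g i = 0.
    by have := in_set0 i; rewrite -S0 inE => /negbFE/eqP.
  rewrite big1 ?mulr0; last by move=> i _; exact: g0.
  by apply: sumr_ge0 => i _; apply: sumr_ge0 => j _; rewrite mulr_ge0.
set S := [set i | g i != 0] in ltk supp i1S *.
case: (@arg_minP _ F T i1 (fun i => i \in S) g i1S) => i0 i0S gmin.
pose m := g i0.
have m_gt0 : 0 < m by rewrite lt_def g_ge0 andbT; move: i0S; rewrite inE.
pose g' i := g i - m * (i \in S)%:R.
have gS i : i \notin S -> g i = 0 by rewrite inE negbK => /eqP.
have g'_ge0 i : 0 <= g' i.
  rewrite /g'; case: (boolP (i \in S)) => iS; last by rewrite mulr0 subr0.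
  by rewrite mulr1 subr_ge0; exact: gmin.
have suppS : [set i | g' i != 0] \subset S :\ i0.
  apply/subsetP => i; rewrite !in_setD1 inE /g'; case: (boolP (i \in S)) => iS.
    by rewrite andbT; apply: contra => /eqP ->; rewrite mulr1 subrr.
  by rewrite (gS _ iS) mulr0 subrr eqxx.
have lt1 : (#|[set i | g' i != 0%R]| < #|S|)%N.
  by apply: leq_ltn_trans (subset_leq_card suppS) _; rewrite (cardsD1 i0 S) i0S.
have := IH g' (leq_trans lt1 ltk) g'_ge0.
have -> : (2 * #|[set i | g' i != 0%R]| <= #|T|)%N.
  by apply: leq_trans supp; rewrite leq_mul2l ltnW.
move=> /(_ isT) IH1.
have -> : \sum_i g i = \sum_i g' i + m * #|S|%:R.
  have -> : #|S|%:R = \sum_i (i \in S)%:R :> F.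
    by rewrite -sum1_card big_mkcond natr_sum; apply: eq_bigr => i _; case: ifP.
  by rewrite mulr_sumr -big_split; apply: eq_bigr => i _; rewrite /g' /= subrK.
(* Across the boundary of [S] exactly one of the two values is 0, so lowering the other by [m]
   shrinks the difference by [m]; all other differences are unchanged. *)
have -> : \sum_i \sum_j A i j * `|g i - g j| =
    \sum_i \sum_j A i j * `|g' i - g' j| + m * (2 * cut S).
  rewrite -sum_abs_indicator mulr_sumr -big_split; apply: eq_bigr => i _ /=.
  rewrite mulr_sumr -big_split; apply: eq_bigr => j _ /=.
  rewrite mulrCA -mulrDr; congr (_ * _).
  have := g'_ge0 i; have := g'_ge0 j; rewrite /g'.
  case: (boolP (i \in S)) => iS; case: (boolP (j \in S)) => jS;
    rewrite ?(gS _ iS) ?(gS _ jS) ?mulr1 ?mulr0 ?subr0 ?sub0r ?subrr ?normrN ?normr0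
      ?normr1 => p1 p2.
  - by rewrite mulr0 addr0; congr (`|_|); ring.
  - by rewrite !ger0_norm //; ring.
  - by rewrite !ger0_norm //; ring.
  - by ring.
have := ler_wpM2l (ltW m_gt0) (hcut _ supp); lra.
Qed.

(** The median is the least value of [f] whose sublevel set contains at least half of the points. *)
Lemma median_exists (f : T -> F) : (0 < #|T|)%N ->
  exists c, (2 * #|[set i | (c < f i)%R]| <= #|T|)%N /\
            (2 * #|[set i | (f i < c)%R]| <= #|T|)%N.
Proof.
move=> /card_gt0P [t0 _].
pose P i := (#|T| <= 2 * #|[set j | (f j <= f i)%R]|)%N.
case: (@arg_maxP _ F T t0 predT f isT) => t1 _ t1max.
have Pt1 : P t1.
  rewrite /P; have -> : [set j | f j <= f t1] = setT.
    by apply/setP => j; rewrite !inE; exact: t1max.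
  by rewrite cardsT leq_pmull.
case: (@arg_minP _ F T t1 P f Pt1) => i Pi imin.
exists (f i); split.
  have -> : [set j | f i < f j] = ~: [set j | f j <= f i].
    by apply/setP => j; rewrite !inE ltNge.
  rewrite cardsCs setCK mulnBr leq_subLR mul2n -addnn.
  by rewrite leq_add2r.
have [/eqP ->|/set0Pn[k]] := boolP ([set j | f j < f i] == set0).
  by rewrite cards0.
rewrite inE => ki.
(* The strict sublevel set of the median is the sublevel set of the next smaller value, which by
   minimality contains less than half of the points. *)
case: (@arg_maxP _ F T k (fun j => f j < f i) f ki) => i' i'i i'max.
have : ~~ P i' by apply/negP => /imin; rewrite leNgt i'i.
rewrite /P -ltnNge => /ltnW; congr (2 * _ <= _)%N; apply: eq_card => j.
rewrite !inE; apply/idP/idP => [h|h]; first exact: le_lt_trans h i'i.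
exact: i'max.
Qed.

(** The [l1] bound is applied to [g^2]; then [|x^2 - y^2| = |x - y| (x + y)] is split by a weighted
    AM-GM inequality, and the degree bound controls the part without differences. *)
Lemma expansion_l2 (h D : F) (g : T -> F) : 0 < h -> 0 < D ->
  (forall S : {set T}, (2 * #|S| <= #|T|)%N -> h * #|S|%:R <= cut S) ->
  (forall i, \sum_j A i j <= D) ->
  (forall i, 0 <= g i) -> (2 * #|[set i | g i != 0%R]| <= #|T|)%N ->
  h ^+ 2 / D * \sum_i g i ^+ 2 <= \sum_i \sum_j A i j * (g i - g j) ^+ 2.
Proof.
move=> h0 D0 hcut hdeg g_ge0 supp.
have h1 : 2 * h * \sum_i g i ^+ 2 <= \sum_i \sum_j A i j * `|g i ^+ 2 - g j ^+ 2|.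
  apply: expansion_l1 => // [i|]; first exact: sqr_ge0.
  rewrite (_ : [set i | _] = [set i | g i != 0]) //.
  by apply/setP => i; rewrite !inE sqrf_eq0.
(* With this weight the part without differences is at most [h G], half of the left-hand side
   [2 h G], and can be absorbed. *)
pose a := h / (2 * D).
have a0 : 0 < a by rewrite divr_gt0 // mulr_gt0.
have h2 : \sum_i \sum_j A i j * `|g i ^+ 2 - g j ^+ 2| <=
    (2 * a)^-1 * (\sum_i \sum_j A i j * (g i - g j) ^+ 2)
    + a * (\sum_i \sum_j A i j * g i ^+ 2 + \sum_i \sum_j A i j * g j ^+ 2).
  rewrite -big_split !mulr_sumr -big_split; apply: ler_sum => i _ /=.
  rewrite -big_split !mulr_sumr -big_split; apply: ler_sum => j _ /=.
  set x := g i; set y := g j; set ia := (2 * a)^-1.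
  have -> : ia * (A i j * (x - y) ^+ 2) + a * (A i j * x ^+ 2 + A i j * y ^+ 2) =
            A i j * (ia * (x - y) ^+ 2 + a * (x ^+ 2 + y ^+ 2)) by ring.
  apply: ler_wpM2l => //; rewrite {}/ia.
  have -> : x ^+ 2 - y ^+ 2 = (x - y) * (x + y) by ring.
  rewrite normrM (ger0_norm (addr_ge0 (g_ge0 _) (g_ge0 _))).
  set u := `|x - y|; have -> : (x - y) ^+ 2 = u ^+ 2 by rewrite /u real_normK ?num_real.
  have q1 : 0 <= (2 * a)^-1 * (u - a * (x + y)) ^+ 2.
    by rewrite mulr_ge0 ?sqr_ge0 // invr_ge0 mulr_ge0 // ltW.
  have q2 : 0 <= a / 2 * (x - y) ^+ 2 by rewrite mulr_ge0 ?sqr_ge0 // divr_ge0 // ltW.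
  rewrite -subr_ge0.
  have -> : (2 * a)^-1 * u ^+ 2 + a * (x ^+ 2 + y ^+ 2) - u * (x + y) =
     (2 * a)^-1 * (u - a * (x + y)) ^+ 2 + a / 2 * (x - y) ^+ 2.
    by field; rewrite gt_eqF.
  exact: addr_ge0.
have h3 : \sum_i \sum_j A i j * g i ^+ 2 <= D * \sum_i g i ^+ 2.
  rewrite mulr_sumr; apply: ler_sum => i _; rewrite -mulr_suml.
  by apply: ler_wpM2r; rewrite ?sqr_ge0.
have h4 : \sum_i \sum_j A i j * g j ^+ 2 = \sum_i \sum_j A i j * g i ^+ 2.
  by rewrite exchange_big /=; apply: eq_bigr => i _; apply: eq_bigr => j _; rewrite A_sym.
set G := \sum_i g i ^+ 2 in h1 h3 *; set E := \sum_i \sum_j A i j * (g i - g j) ^+ 2 in h2 *.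
have h5 : 2 * h * G <= (2 * a)^-1 * E + a * (2 * D * G).
  apply: le_trans h1 (le_trans h2 _); rewrite lerD2l h4 ler_pM2l //; lra.
have e1 : a * (2 * D * G) = h * G by rewrite /a; field; rewrite gt_eqF.
have h6 : h * G <= (2 * a)^-1 * E by lra.
have -> : h ^+ 2 / D * G = 2 * a * (h * G) by rewrite /a; field; rewrite gt_eqF.
have := ler_wpM2l (ltW (mulr_gt0 (ltr0Sn F 1) a0)) h6.
by rewrite mulVKf // gt_eqF // mulr_gt0.
Qed.

(** Around a median [c], the positive and negative parts of [f - c] are each supported on at most
    half of the points. Their squares add up to [(f - c)^2], and their energies add up to at most
    that of [f]. *)
Lemma cheeger (h D : F) (f : T -> F) : 0 < h -> 0 < D ->
  (forall S : {set T}, (2 * #|S| <= #|T|)%N -> h * #|S|%:R <= cut S) ->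
  (forall i, \sum_j A i j <= D) ->
  exists c, h ^+ 2 / D * \sum_i (f i - c) ^+ 2 <=
            \sum_i \sum_j A i j * (f i - f j) ^+ 2.
Proof.
move=> h0 D0 hcut hdeg.
have [T0|Tpos] := posnP #|T|.
  exists 0; have T0' : T =i pred0 by exact: card0_eq.
  rewrite !big1 ?mulr0 // => i; by have := T0' i; rewrite inE.
have [c [c1 c2]] := median_exists f Tpos; exists c.
pose fp i := Num.max (f i - c) 0; pose fm i := Num.max (c - f i) 0.
have p0 i : 0 <= fp i by rewrite le_max lexx orbT.
have m0 i : 0 <= fm i by rewrite le_max lexx orbT.
have maxE (z : F) : (Num.max z 0 != 0) = (0 < z).
  by case: (leP z 0) => hz; rewrite ?eqxx ?gt_eqF.
have sp : [set i | fp i != 0] = [set i | c < f i].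
  by apply/setP => i; rewrite !inE /fp maxE subr_gt0.
have sm : [set i | fm i != 0] = [set i | f i < c].
  by apply/setP => i; rewrite !inE /fm maxE subr_gt0.
have Hp : (2 * #|[set i | fp i != 0%R]| <= #|T|)%N by rewrite sp.
have Hm : (2 * #|[set i | fm i != 0%R]| <= #|T|)%N by rewrite sm.
have := lerD (expansion_l2 h0 D0 hcut hdeg p0 Hp) (expansion_l2 h0 D0 hcut hdeg m0 Hm).
rewrite -mulrDr -!big_split /= => H; apply: le_trans (le_trans H _).
  apply: ler_wpM2l; first by rewrite divr_ge0 ?sqr_ge0 // ltW.
  by apply: ler_sum => i _; rewrite /fp /fm !maxEle; case: ifP; case: ifP => *; nra.
apply: ler_sum => i _; rewrite -big_split; apply: ler_sum => j _ /=.
rewrite -mulrDr; apply: ler_wpM2l => //.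
by rewrite /fp /fm !maxEle; do 4 (case: (leP _ 0) => ?); nra.
Qed.

End Cheeger.

(** * Energy identity for the balance equations and the resulting perturbation bound *)

Section Stability.
Local Open Scope ring_scope.

Variables (F : realFieldType) (T : finType) (A y : T -> T -> F).
Hypothesis A_ge0 : forall i j, 0 <= A i j.
Hypothesis A_sym : forall i j, A i j = A j i.
Hypothesis y_ge0 : forall i j, 0 <= y i j.
(** The factor [A] removes the diagonal, where [yavg] is 0 and the two averages do not sum to 1. *)
Hypothesis y_anti : forall i j, A i j * (y i j + y j i) = A i j.

(** Inflow minus outflow at [j] for the mass distribution [u]. *)
Definition defect (u : T -> F) (j : T) : F :=
  \sum_i A i j * (u i * y i j - u j * y j i).

(** Summation by parts: exchanging the two indices turns the outflow part into an inflow part tested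
    against the other endpoint. *)
Lemma defect_pairing (v g : T -> F) :
  \sum_j g j * defect v j = \sum_j \sum_i A i j * (v i * y i j * (g j - g i)).
Proof.
pose G j i := A i j * (v i * y i j * g i).
transitivity (\sum_j \sum_i A i j * (v i * y i j * g j) - \sum_j \sum_i G j i).
  rewrite [X in _ - X]exchange_big /= -sumrB; apply: eq_bigr => j _.
  rewrite /defect mulr_sumr -sumrB; apply: eq_bigr => i _.
  by rewrite /G (A_sym j i); ring.
by rewrite -sumrB; apply: eq_bigr => j _; rewrite -sumrB; apply: eq_bigr => i _; rewrite /G; ring.
Qed.

(* The remainder is diagonal because the quadratic part of [u_i y_ij f_i (f_j - f_i)]
   telescopes to [f_j^2 - f_i^2]. *)
Lemma dirichlet_identity (u pi f : T -> F) :
  (forall i, pi i - u i = u i * f i) -> (forall j, defect pi j = 0) ->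
  2^-1 * (\sum_j \sum_i A i j * (u i * y i j) * (f i - f j) ^+ 2) =
    \sum_j f j * defect u j + 2^-1 * \sum_j f j ^+ 2 * defect u j.
Proof.
move=> hf hpi.
have h0 : \sum_j \sum_i A i j * (pi i * y i j * (f j - f i)) = 0.
  by rewrite -defect_pairing big1 // => j _; rewrite hpi mulr0.
rewrite (defect_pairing u f) (defect_pairing u (fun j => f j ^+ 2)).
(* Once the vanishing pairing is added, the identity holds term by term: [(f_i - f_j)^2 / 2 + f_i
   (f_j - f_i) = (f_j^2 - f_i^2) / 2]. *)
rewrite -[LHS]addr0 -[X in _ + X = _]h0 !mulr_sumr -!big_split; apply: eq_bigr => j _ /=.
rewrite !mulr_sumr -!big_split; apply: eq_bigr => i _ /=.
have -> : pi i = u i + u i * f i by rewrite -hf addrC subrK.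
by field.
Qed.

Lemma stationary_stability (u pi : T -> F) (m k lam : F) :
  0 < m -> 1 <= k -> 0 < lam -> (forall i, m <= u i <= k * m) ->
  (forall j, defect pi j = 0) -> \sum_i pi i = \sum_i u i ->
  (forall f : T -> F, exists c, lam * \sum_i (f i - c) ^+ 2 <=
     \sum_i \sum_j A i j * (f i - f j) ^+ 2) ->
  (forall j, `|defect u j| <= m * lam / (4 * k)) ->
  \sum_i (pi i - u i) ^+ 2 <= 64 * k ^+ 4 / lam ^+ 2 * \sum_j defect u j ^+ 2.
Proof.
move=> m0 k1 lam0 hu hpi hsum gap hb.
have k0 : 0 < k by lra.
have u0 i : 0 < u i by have /andP[h _] := hu i; lra.
pose f i := (pi i - u i) / u i.
have hf i : pi i - u i = u i * f i by rewrite /f mulrC divfK // gt_eqF.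
have dir := dirichlet_identity hf hpi.
have [c hc] := gap f.
pose V := \sum_i (f i - c) ^+ 2; pose N := \sum_i f i ^+ 2.
pose B := \sum_j defect u j ^+ 2.
have uf0 : \sum_i u i * f i = 0.
  by under eq_bigr do rewrite -hf; rewrite sumrB hsum subrr.
(* The [u]-weighted mean of [f] is 0, so recentring at [c] can only increase the weighted sum of
   squares; passing between weighted and plain sums costs the ratio [k]. *)
have NV : N <= k * V.
  rewrite -(ler_pM2l m0) mulrA [m * k]mulrC.
  apply: (@le_trans _ _ (\sum_i u i * f i ^+ 2)).
    rewrite mulr_sumr; apply: ler_sum => i _; apply: ler_wpM2r; first exact: sqr_ge0.
    by have /andP[] := hu i.
  apply: (@le_trans _ _ (\sum_i u i * (f i - c) ^+ 2)).
    have -> : \sum_i u i * (f i - c) ^+ 2 =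
        \sum_i u i * f i ^+ 2 + c ^+ 2 * \sum_i u i - 2 * c * \sum_i u i * f i.
      rewrite !mulr_sumr -big_split -sumrB; apply: eq_bigr => i _ /=; ring.
    rewrite uf0 mulr0 subr0 lerDl mulr_ge0 ?sqr_ge0 //.
    by apply: sumr_ge0 => i _; exact: ltW.
  rewrite mulr_sumr; apply: ler_sum => i _; apply: ler_wpM2r; first exact: sqr_ge0.
  by have /andP[] := hu i.
have lower : m * 2^-1 * (\sum_i \sum_j A i j * (f i - f j) ^+ 2) <=
    \sum_j \sum_i A i j * (u i * y i j) * (f i - f j) ^+ 2.
  (* Averaging over the two orientations of an edge replaces [y i j] by 1/2. *)
  have sym : \sum_j \sum_i A i j * y i j * (f i - f j) ^+ 2 =
             2^-1 * \sum_i \sum_j A i j * (f i - f j) ^+ 2.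
    pose G i j := A i j * y i j * (f i - f j) ^+ 2.
    pose S := \sum_j \sum_i G i j.
    suff e : S + S = \sum_i \sum_j A i j * (f i - f j) ^+ 2.
      by rewrite -e -/S; field.
    rewrite {1}/S exchange_big -big_split; apply: eq_bigr => i _ /=.
    rewrite -big_split; apply: eq_bigr => j _ /=.
    by rewrite /G (A_sym j i) -[in RHS](y_anti i j); ring.
  rewrite -mulrA -sym mulr_sumr; apply: ler_sum => j _.
  rewrite mulr_sumr; apply: ler_sum => i _.
  have -> : m * (A i j * y i j * (f i - f j) ^+ 2) = A i j * (m * y i j) * (f i - f j) ^+ 2.
    by ring.
  apply: ler_wpM2r; first exact: sqr_ge0.
  by apply: ler_wpM2l => //; apply: ler_wpM2r => //; have /andP[] := hu i.
(* Here [2 a] is the assumed bound on the defects. The energy side is at least [2 a N]; the diagonal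
   term takes [a N] of it and the linear term [a N / 2], which leaves [a N / 2] against
   [B / (2 a)]. *)
pose a := m * lam / (8 * k).
have a0 : 0 < a by rewrite divr_gt0 // mulr_gt0.
have diag : \sum_j f j ^+ 2 * defect u j <= 2 * a * N.
  rewrite /N mulr_sumr; apply: ler_sum => j _; rewrite mulrC.
  apply: ler_wpM2r; first exact: sqr_ge0.
  apply: le_trans (ler_norm _) (le_trans (hb j) _).
  by rewrite le_eqVlt; apply/orP; left; apply/eqP; rewrite /a; field; rewrite gt_eqF.
have lin : \sum_j f j * defect u j <= a / 2 * N + (2 * a)^-1 * B.
  rewrite /N /B !mulr_sumr -big_split; apply: ler_sum => j _ /=.
  set x := f j; set z := defect u j.
  have q : 0 <= (2 * a)^-1 * (a * x - z) ^+ 2.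
    by rewrite mulr_ge0 ?sqr_ge0 // invr_ge0 mulr_ge0 // ltW.
  rewrite -subr_ge0; apply: le_trans q _; rewrite le_eqVlt; apply/orP; left; apply/eqP.
  by field; rewrite gt_eqF.
have hV : 4 * a * N <= m * lam * 2^-1 * V.
  have -> : 4 * a * N = m * lam * 2^-1 / k * N by rewrite /a; field; rewrite gt_eqF.
  rewrite -mulrA ler_pM2l ?mulr_gt0 ?invr_gt0 //.
  by rewrite mulrC ler_pdivrMr // mulrC.
have fin : a * N <= a^-1 * B.
  have e : (2 * a)^-1 * B = 2^-1 * (a^-1 * B) by rewrite invfM mulrA.
  have h := ler_wpM2l (ltW m0) hc.
  rewrite e in lin; rewrite -/V in h; lra.
have -> : 64 * k ^+ 4 / lam ^+ 2 * B = (k * m) ^+ 2 * (a^-1 * (a^-1 * B)).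
  by rewrite /a; field; rewrite !gt_eqF.
apply: (@le_trans _ _ ((k * m) ^+ 2 * N)).
  rewrite mulr_sumr; apply: ler_sum => i _; rewrite hf exprMn.
  apply: ler_wpM2r; first exact: sqr_ge0.
  have /andP[_ h] := hu i; rewrite ler_sqr // nnegrE; first exact: ltW.
  by rewrite mulr_ge0 // ltW.
apply: ler_wpM2l; first exact: sqr_ge0.
by rewrite mulrC ler_pdivlMr // mulrC.
Qed.
End Stability.

(** * Moment generating functions *)

Section BigSums.
Local Open Scope ring_scope.

Lemma sum_prod (V : nmodType) (I J : finType) (G : I * J -> V) :
  \sum_s G s = \sum_i \sum_j G (i, j).
Proof. by rewrite pair_bigA; apply: eq_bigr => -[]. Qed.

Lemma ler_sum_term (F : numDomainType) (I : finType) (P : pred I) (f : I -> F) i :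
  (forall i, 0 <= f i) -> P i -> f i <= \sum_(i | P i) f i.
Proof. by move=> f0 Pi; rewrite (bigD1 i) //= lerDl sumr_ge0. Qed.

End BigSums.

(** * Elementary inequalities for the exponential *)

Section Exponential.
Local Open Scope ring_scope.

Lemma expD (x y : R) : exp (x + y) = exp x * exp y.
Proof. exact: exp_plus. Qed.

Lemma exp0 : exp 0 = 1 :> R.
Proof. exact: exp_0. Qed.

Lemma expX (x : R) n : exp x ^+ n = exp (x *+ n).
Proof. exact: expRX. Qed.

Lemma expN (x : R) : exp (- x) = (exp x)^-1.
Proof. exact: exp_Ropp. Qed.

Lemma exp_gt0 (x : R) : 0 < exp x.
Proof. by apply/RltP; exact: exp_pos. Qed.

Lemma exp_ge0 (x : R) : 0 <= exp x.
Proof. exact/ltW/exp_gt0. Qed.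

Lemma le1D_exp (x : R) : 1 + x <= exp x.
Proof. by apply/RleP; exact: exp_ineq1_le. Qed.

Lemma ler_exp (x y : R) : x <= y -> exp x <= exp y.
Proof.
rewrite le_eqVlt => /orP[/eqP-> //|/RltP h].
by apply/ltW/RltP; exact: exp_increasing.
Qed.

Lemma exp_sum (I : Type) (r : seq I) (P : pred I) (f : I -> R) :
  exp (\sum_(i <- r | P i) f i) = \prod_(i <- r | P i) exp (f i).
Proof. by apply: (big_morph exp) => [x y|]; rewrite ?expD // exp0. Qed.

Lemma exp_le_inv (x : R) : x < 1 -> exp x <= (1 - x)^-1.
Proof.
move=> x1; have h : 0 < 1 - x by lra.
rewrite -[_^-1]mul1r ler_pdivlMr // mulrC.
rewrite -[X in _ <= X]exp0 -(addNr x) expD.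
by apply: ler_wpM2r; [exact: exp_ge0 | have := le1D_exp (- x); lra].
Qed.

(** The linear term averages to 0 over a centred variable, which leaves a sub-Gaussian bound. *)
Lemma exp_le_addsqr (x : R) : exp x <= x + exp (2 * x ^+ 2).
Proof.
have h := le1D_exp (2 * x ^+ 2).
have [x12|x12] := leP (2^-1) x.
  have := ler_exp (_ : x <= 2 * x ^+ 2) => /(_ ltac:(nra)); lra.
apply: le_trans (exp_le_inv _) _; first lra.
have x1 : 0 < 1 - x by lra.
apply: (@le_trans _ _ (1 + x + 2 * x ^+ 2)); last lra.
rewrite -[_^-1]mul1r ler_pdivrMr //.
have : 0 <= x ^+ 2 * (1 - 2 * x) by rewrite mulr_ge0 ?sqr_ge0; lra.
by nra.
Qed.

Lemma expN1_le_half : exp (- 1) <= 2^-1.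
Proof.
by apply: le_trans (exp_le_inv _) _; [lra | rewrite opprK].
Qed.

Lemma exp_lt1 (x : R) : exp x < 1 -> x < 0.
Proof. by move=> h; rewrite ltNge; apply/negP => x0; have := le1D_exp x; lra. Qed.

Lemma exp_neg_le (N x : R) : 0 < N -> 6 * ln N <= x -> exp (- x) <= (N ^+ 6)^-1.
Proof.
move=> N0 h.
have -> : (N ^+ 6)^-1 = exp (- (6 * ln N)).
  have e : exp (6 * ln N) = N ^+ 6.
    have eN : exp (ln N) = N by apply: exp_ln; exact/RltP.
    by rewrite -[X in _ = X ^+ _]eN expX -[in RHS]mulr_natl.
  by rewrite -e expN.
by apply: ler_exp; rewrite lerN2.
Qed.

Lemma ln_bounds (n : nat) : (0 < n)%N -> 0 <= ln n%:R <= n%:R.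
Proof.
move=> n0; have nR : 0 < n%:R :> R by rewrite ltr0n.
have e : exp (ln n%:R) = n%:R by apply: exp_ln; exact/RltP.
apply/andP; split; last by have := le1D_exp (ln n%:R); rewrite e; lra.
rewrite leNgt; apply/negP => h.
have : 1 <= n%:R :> R by rewrite ler1n.
have x1 : 0 < 1 - ln n%:R by lra.
have : exp (ln n%:R) <= (1 - ln n%:R)^-1 by apply: exp_le_inv; lra.
rewrite e => h1 h2; have := le_trans h2 h1.
by rewrite -[_^-1]mul1r ler_pdivlMr // mul1r; lra.
Qed.

End Exponential.

(** * Exponential moments of independent Bernoulli variables *)

Section Bernoulli.
Local Open Scope ring_scope.

Variables (T : finType) (q : T -> R).

Definition bern (a : {ffun T -> bool}) : R := \prod_t (if a t then q t else 1 - q t).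

Lemma bern_prod (G : T -> bool -> R) :
  \sum_a bern a * \prod_t G t (a t) = \prod_t (q t * G t true + (1 - q t) * G t false).
Proof.
transitivity (\sum_(a : {ffun T -> bool})
    \prod_t ((if a t then q t else 1 - q t) * G t (a t))).
  by apply: eq_bigr => a _; rewrite big_split.
rewrite -(bigA_distr_bigA (fun t (b : bool) => (if b then q t else 1 - q t) * G t b)).
by apply: eq_bigr => t _; rewrite big_bool.
Qed.

Lemma bern_sum1 : \sum_a bern a = 1.
Proof.
transitivity (\sum_a bern a * \prod_(t : T) 1).
  by apply: eq_bigr => a _; rewrite big1 ?mulr1.
by rewrite (bern_prod (fun _ _ => 1)) big1 // => t _; ring.
Qed.

Hypothesis q01 : forall t, 0 <= q t <= 1.

Lemma bern_ge0 a : 0 <= bern a.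
Proof.
apply: prodr_ge0 => t _; have /andP[h1 h2] := q01 t; case: (a t) => //; lra.
Qed.

Lemma bern_mgf_le (c : T -> R) :
  \sum_a bern a * exp (\sum_t c t * (a t)%:R) <= exp (\sum_t q t * (exp (c t) - 1)).
Proof.
under eq_bigr do rewrite exp_sum.
rewrite (bern_prod (fun t b => exp (c t * b%:R))) exp_sum.
apply: ler_prod => t _; have /andP[h1 h2] := q01 t.
rewrite mulr1 mulr0 exp0 mulr1; apply/andP; split.
  by have := mulr_ge0 h1 (exp_ge0 (c t)); lra.
by have := le1D_exp (q t * (exp (c t) - 1)); lra.
Qed.

Lemma bern_mgf_centered (c : T -> R) :
  \sum_a bern a * exp (\sum_t c t * ((a t)%:R - q t)) <= exp (2 * \sum_t c t ^+ 2).
Proof.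
under eq_bigr do rewrite exp_sum.
rewrite (bern_prod (fun t b => exp (c t * (b%:R - q t)))) mulr_sumr exp_sum.
apply: ler_prod => t _; have /andP[h1 h2] := q01 t.
have step (x : R) : -1 <= x <= 1 -> exp (c t * x) <= c t * x + exp (2 * c t ^+ 2).
  move=> hx; apply: le_trans (exp_le_addsqr _) _; rewrite lerD2l; apply: ler_exp.
  rewrite exprMn mulrA -[leRHS]mulr1; apply: ler_wpM2l; last by nra.
  by rewrite mulr_ge0 ?sqr_ge0.
have s1 := step (1 - q t) ltac:(lra); have s0 := step (0 - q t) ltac:(lra).
apply/andP; split.
  by rewrite addr_ge0 // mulr_ge0 ?exp_ge0 //; lra.
(* The linear terms cancel because [q (1 - q) + (1 - q) (0 - q) = 0]. *)
have := lerD (ler_wpM2l h1 s1) (ler_wpM2l (_ : 0 <= 1 - q t) s0).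
move=> /(_ ltac:(lra)) h; apply: le_trans h _; lra.
Qed.

End Bernoulli.

(** * Exponential moment of a squared norm from those of linear forms *)

Section ExpSquare.
Local Open Scope ring_scope.

(* Index [k = (s, m)] stands for the integer [m] with sign [s]. *)
Definition grid (M : nat) (k : bool * 'I_M) : R := (-1) ^+ k.1 * (k.2 : nat)%:R.

(* The maximum of [m x - m^2] over integers [m] is within 1 of [x^2 / 4]. *)
Lemma exp_sq_le_grid (M : nat) (x : R) : `|x| < 2 * M%:R ->
  exp (4^-1 * x ^+ 2) <= 3 * \sum_(k : bool * 'I_M) exp (grid k * x - grid k ^+ 2).
Proof.
move=> xM.
(* With [m] the integer part of [|x| / 2], the loss [x^2 / 4 - (m |x| - m^2) = (|x| / 2 - m)^2] is
   at most 1; the factor 3 pays for it through [exp 1 <= 3]. *)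
have [m [m1 m2]] : exists m : nat, (m%:R : R) <= `|x| / 2 /\ `|x| / 2 < m.+1%:R.
  have /andP[m1 m2] := truncn_itv (divr_ge0 (normr_ge0 x) (ler0n R 2)).
  by exists (Num.truncn (`|x| / 2)).
have mM : (m < M)%N.
  by rewrite -(ltr_nat R); apply: le_lt_trans m1 _; rewrite ltr_pdivrMr // mulrC.
pose k := (x < 0, Ordinal mM).
rewrite (bigD1 k) //= mulrDr -[leLHS]addr0; apply: lerD; last first.
  by apply: mulr_ge0 => //; apply: sumr_ge0 => *; exact: exp_ge0.
have e3 : exp 1 <= 3 by apply/RleP; have := exp_le_3; rewrite /Rdiv //.
apply: (@le_trans _ _ (exp 1 * exp (grid k * x - grid k ^+ 2))); last first.
  by apply: ler_wpM2r => //; exact: exp_ge0.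
rewrite -expD; apply: ler_exp.
have -> : grid k * x = m%:R * `|x|.
  rewrite /grid /k /=; case: (ltP x 0) => hx /=.
    by rewrite expr1 ltr0_norm //; ring.
  by rewrite expr0 ger0_norm //; ring.
have -> : grid k ^+ 2 = m%:R ^+ 2 by rewrite /grid exprMn -signr_odd sqrr_sign mul1r.
have -> : x ^+ 2 = `|x| ^+ 2 by rewrite real_normK ?num_real.
have := m1; have := m2; rewrite -natr1; nra.
Qed.

(** Since [m <= m^2], each sign contributes at most a geometric series of ratio 2/3, whose sum is at
    most 3; and 18 is [3 * 2 * 3]. *)
Lemma sum_exp_grid (M : nat) :
  3 * \sum_(k : bool * 'I_M) exp (- 2^-1 * grid k ^+ 2) <= 18.
Proof.
have r23 : exp (- 2^-1) <= 2 / 3.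
  by apply: le_trans (exp_le_inv _) _; [lra | rewrite -[_^-1]mul1r ler_pdivrMr; lra].
have geo : forall K : nat, \sum_(m < K) (2 / 3 : R) ^+ m = 3 * (1 - (2 / 3) ^+ K).
  by elim=> [|K IH]; rewrite ?big_ord0 ?big_ord_recr ?IH /= ?expr0 ?exprS; field.
have -> : \sum_(k : bool * 'I_M) exp (- 2^-1 * grid k ^+ 2)
    = \sum_(s : bool) \sum_(m < M) exp (- 2^-1 * (m : nat)%:R ^+ 2).
  rewrite pair_bigA /=; apply: eq_bigr => k _.
  by rewrite /grid exprMn -signr_odd sqrr_sign mul1r.
have h : \sum_(m < M) exp (- 2^-1 * (m : nat)%:R ^+ 2) <= 3.
  apply: (@le_trans _ _ (\sum_(m < M) (2 / 3 : R) ^+ m)); last first.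
    have : 0 <= (2 / 3 : R) ^+ M by apply: exprn_ge0; lra.
    by rewrite geo; lra.
  apply: ler_sum => m _; apply: (@le_trans _ _ (exp (- 2^-1) ^+ m)); last first.
    by rewrite lerXn2r ?nnegrE ?exp_ge0 //; lra.
  rewrite expX; apply: ler_exp; rewrite -mulr_natr.
  suff : (m : nat)%:R <= (m : nat)%:R ^+ 2 :> R by lra.
  by rewrite -natrX ler_nat -mulnn; case: (nat_of_ord m) => // *; rewrite leq_pmulr.
rewrite big_bool /=; lra.
Qed.

(* [exp (x^2 / 4)] is a mixture of exponentials [exp (m x)], so a sub-Gaussian
   bound for all linear forms controls the norm of the vector. *)
Lemma exp_sq_moment (Om T : finType) (P : Om -> R) (X : Om -> T -> R) :
  (forall om, 0 <= P om) ->
  (forall m : T -> R, \sum_om P om * exp (\sum_j m j * X om j)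
     <= exp (2^-1 * \sum_j m j ^+ 2)) ->
  \sum_om P om * exp (4^-1 * \sum_j X om j ^+ 2) <= 18 ^+ #|T|.
Proof.
move=> P_ge0 hX.
(* The sample space is finite, so one grid size [M] serves all outcomes; the final bound does not
   depend on it. *)
pose B := \sum_om \sum_j `|X om j|.
pose M := Num.bound B.
have XM om j : `|X om j| < 2 * M%:R.
  have hB : B < M%:R.
    apply: archi_boundP; apply: sumr_ge0 => *; exact: sumr_ge0.
  have h : `|X om j| <= B.
    rewrite /B (bigD1 om) //= (bigD1 j) //= -addrA lerDl addr_ge0 //.
      exact: sumr_ge0.
    by apply: sumr_ge0 => *; exact: sumr_ge0.
  have : 0 <= `|X om j| by []; lra.
pose K := (bool * 'I_M)%type.
apply: (@le_trans _ _ (\sum_om P om * (3 ^+ #|T| * \sum_(phi : {ffun T -> K})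
   exp (\sum_j grid (phi j) * X om j - \sum_j grid (phi j) ^+ 2)))).
  apply: ler_sum => om _; apply: ler_wpM2l => //.
  rewrite mulr_sumr exp_sum.
  apply: (@le_trans _ _ (\prod_j (3 * \sum_(k : K) exp (grid k * X om j - grid k ^+ 2)))).
    by apply: ler_prod => j _; rewrite exp_ge0 exp_sq_le_grid.
  rewrite big_split /= prodr_const bigA_distr_bigA /=.
  by rewrite le_eqVlt; apply/orP; left; apply/eqP; congr (_ * _);
    apply: eq_bigr => phi _; rewrite -exp_sum sumrB.
have -> : \sum_om P om * (3 ^+ #|T| * \sum_(phi : {ffun T -> K})
   exp (\sum_j grid (phi j) * X om j - \sum_j grid (phi j) ^+ 2)) =
  3 ^+ #|T| * \sum_(phi : {ffun T -> K}) exp (- \sum_j grid (phi j) ^+ 2) *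
    \sum_om P om * exp (\sum_j grid (phi j) * X om j).
  under eq_bigr do rewrite mulrCA mulr_sumr.
  rewrite -mulr_sumr exchange_big /=; congr (_ * _); apply: eq_bigr => phi _.
  by rewrite mulr_sumr; apply: eq_bigr => om _; rewrite expD; ring.
(* The weight [exp (- |m|^2)] beats the moment [exp (|m|^2 / 2)], and what remains factorizes over
   the coordinates. *)
apply: (@le_trans _ _ (3 ^+ #|T| * \sum_(phi : {ffun T -> K})
     \prod_j exp (- 2^-1 * grid (phi j) ^+ 2))).
  apply: ler_wpM2l; first exact: exprn_ge0.
  apply: ler_sum => phi _.
  apply: le_trans (ler_wpM2l (exp_ge0 _) (hX _)) _.
  rewrite -expD -exp_sum; apply: ler_exp; rewrite -mulr_sumr; lra.
rewrite -(bigA_distr_bigA (fun j k => exp (- 2^-1 * grid k ^+ 2))) /=.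
rewrite -prodr_const -big_split /= -prodr_const; apply: ler_prod => j _.
rewrite sum_exp_grid andbT; apply: mulr_ge0 => //.
by apply: sumr_ge0 => *; exact: exp_ge0.
Qed.

End ExpSquare.

(** * The random comparison graph *)

Section RandomGraph.
Local Open Scope ring_scope.

Variables (n : nat) (p : R).
Implicit Types (g : {ffun 'I_n * 'I_n -> bool}) (i j k : 'I_n) (t : 'I_n * 'I_n).

Definition upper t : R := (t.1 < t.2)%N%:R.

(** Parameter 0 off the upper triangle forces the dummy coordinates to [false], so the graph law is
    a plain product of Bernoulli laws. *)
Definition edge_prob t : R := if (t.1 < t.2)%N then p else 0.

Definition adjw g i j : R := ((i < j)%N && g (i, j) || (j < i)%N && g (j, i))%:R.

Lemma adjw_ge0 g i j : 0 <= adjw g i j.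
Proof. exact: ler0n. Qed.

Lemma adjw_sym g i j : adjw g i j = adjw g j i.
Proof. by rewrite /adjw orbC. Qed.

(** Folding onto the pairs with [i < j] expresses a symmetric sum through independent
    coordinates. *)
Lemma adjw_sum g (F : 'I_n -> 'I_n -> R) :
  \sum_i \sum_j adjw g i j * F i j =
  \sum_t upper t * (g t)%:R * (F t.1 t.2 + F t.2 t.1).
Proof.
transitivity (\sum_i \sum_j upper (i, j) * (g (i, j))%:R * F i j
            + \sum_i \sum_j upper (i, j) * (g (i, j))%:R * F j i).
  rewrite [X in _ = _ + X]exchange_big -big_split; apply: eq_bigr => i _ /=.
  rewrite -big_split; apply: eq_bigr => j _ /=; rewrite /adjw /upper /=.
  by case: ltngtP => _ /=; rewrite ?orbF; ring.
rewrite !pair_bigA -big_split; apply: eq_bigr => t _ /=.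
by rewrite -surjective_pairing; ring.
Qed.

Lemma complete_sum (F : 'I_n -> 'I_n -> R) :
  \sum_i \sum_j (i != j)%:R * F i j = \sum_t upper t * (F t.1 t.2 + F t.2 t.1).
Proof.
transitivity (\sum_i \sum_j adjw [ffun=> true] i j * F i j).
  apply: eq_bigr => i _; apply: eq_bigr => j _; congr (_%:R * _).
  by rewrite !ffunE !andbT -neq_ltn.
by rewrite adjw_sum; apply: eq_bigr => t _; rewrite ffunE mulr1.
Qed.

Hypothesis p01 : 0 <= p <= 1.

Lemma edge_prob01 t : 0 <= edge_prob t <= 1.
Proof. by rewrite /edge_prob; case: ifP => _ //; rewrite lexx ler01. Qed.

(** The slope [r] linearizes [exp x - 1] at the values that occur: 2 for degrees, where [x] is 0 or
    1, and 1/2 for cuts, where [x] is 0 or -1. *)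
Lemma adjw_mgf (F : 'I_n -> 'I_n -> R) (r : R) :
  (forall i j, i != j -> exp (F i j + F j i) - 1 <= r * (F i j + F j i)) ->
  \sum_g bern edge_prob g * exp (\sum_i \sum_j adjw g i j * F i j) <=
  exp (p * r * \sum_i \sum_j (i != j)%:R * F i j).
Proof.
move=> hF; pose c t := upper t * (F t.1 t.2 + F t.2 t.1).
apply: (@le_trans _ _ (\sum_g bern edge_prob g * exp (\sum_t c t * (g t)%:R))).
  apply: ler_sum => g _; rewrite adjw_sum le_eqVlt; apply/orP; left; apply/eqP.
  by congr (_ * exp _); apply: eq_bigr => t _; rewrite /c; ring.
apply: le_trans (bern_mgf_le edge_prob01 c) _; apply: ler_exp.
rewrite complete_sum mulr_sumr; apply: ler_sum => t _.
rewrite /edge_prob /c /upper; case: ltnP => ht; last by rewrite !mul0r mulr0.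
rewrite !mul1r -mulrA; apply: ler_wpM2l; first by case/andP: p01.
by apply: hF; rewrite neq_ltn ht.
Qed.

Lemma degree_mgf k :
  \sum_g bern edge_prob g * exp (\sum_j adjw g k j) <= exp (2 * (n%:R * p)).
Proof.
have e3 : exp 1 <= 3 by apply/RleP; exact: exp_le_3.
pose F i j : R := (i == k)%:R.
have hF g : \sum_j adjw g k j = \sum_i \sum_j adjw g i j * F i j.
  rewrite [RHS](bigD1 k) //= [X in _ = _ + X]big1 ?addr0 => [|i ik].
    by apply: eq_bigr => j _; rewrite /F eqxx mulr1.
  by rewrite big1 // => j _; rewrite /F (negbTE ik) mulr0.
under eq_bigr do rewrite hF.
apply: le_trans (@adjw_mgf F 2 _) _ => [i j ij|].
  rewrite /F; have [ik|ik] := eqVneq i k; have [jk|jk] := eqVneq j k => /=.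
  - by rewrite ik jk eqxx in ij.
  - by rewrite addr0; lra.
  - by rewrite add0r; lra.
  - by rewrite addr0 exp0; lra.
apply: ler_exp; have /andP[p0 _] := p01.
suff : \sum_i \sum_j (i != j)%:R * F i j <= n%:R by move=> h; nra.
rewrite (bigD1 k) //= [X in _ + X]big1 ?addr0 => [|i ik]; last first.
  by rewrite big1 // => j _; rewrite /F (negbTE ik) mulr0.
rewrite -[X in _ <= X%:R]card_ord -sum1_card natr_sum; apply: ler_sum => j _.
by rewrite /F eqxx mulr1; case: (k != j).
Qed.

Lemma cut_mgf (S : {set 'I_n}) :
  \sum_g bern edge_prob g * exp (- cut (adjw g) S) <=
  exp (- (p * 2^-1 * (#|S|%:R * (n%:R - #|S|%:R)))).
Proof.
pose F i j : R := - ((i \in S)%:R * (j \notin S)%:R).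
have hF g : - cut (adjw g) S = \sum_i \sum_j adjw g i j * F i j.
  by rewrite /cut -sumrN; apply: eq_bigr => i _; rewrite -sumrN;
    apply: eq_bigr => j _; rewrite mulrN.
under eq_bigr do rewrite hF.
apply: le_trans (@adjw_mgf F (2^-1) _) _ => [i j ij|].
  have e2 := expN1_le_half; rewrite /F.
  case: (i \in S); case: (j \in S) => /=.
  - by rewrite mulr0 oppr0 addr0 exp0; lra.
  - by rewrite mulr1 mul0r oppr0 addr0; lra.
  - by rewrite mulr1 mul0r oppr0 add0r; lra.
  - by rewrite mul0r oppr0 addr0 exp0; lra.
apply: ler_exp; rewrite -mulrN le_eqVlt; apply/orP; left; apply/eqP; congr (_ * _).
have card_sum (B : {set 'I_n}) : #|B|%:R = \sum_i (i \in B)%:R :> R.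
  by rewrite -sum1_card big_mkcond natr_sum; apply: eq_bigr => i _; case: ifP.
have -> : n%:R - #|S|%:R = #|~: S|%:R :> R.
  by rewrite -[X in X%:R - _]card_ord -(cardsC S) natrD addrC addKr.
rewrite !card_sum mulr_suml -sumrN; apply: eq_bigr => i _.
rewrite mulr_sumr -sumrN; apply: eq_bigr => j _; rewrite /F in_setC.
have [->|ij] := eqVneq i j; last by rewrite mul1r.
by case: (j \in S) => /=; ring.
Qed.

End RandomGraph.

(** * Exponential moments of the defects for a fixed graph *)

Section Comparisons.
Local Open Scope ring_scope.

Variables (n L : nat) (w u : 'I_n -> R) (U : R).
Implicit Types (g : {ffun 'I_n * 'I_n -> bool}) (Y : {ffun 'I_n * 'I_n * 'I_L -> bool}).

Definition cmp_prob (s : 'I_n * 'I_n * 'I_L) : R :=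
  if (s.1.1 < s.1.2)%N then ystar w s.1.1 s.1.2 else 0.

Hypothesis L_gt0 : (0 < L)%N.
Hypothesis w_gt0 : forall i, 0 < w i.
Hypothesis uw : forall i j, u i * w j = u j * w i.
Hypothesis u_bound : forall i, 0 <= u i <= U.

Lemma ystarE i j : ystar w i j = w j / (w i + w j).
Proof. by []. Qed.

Lemma cmp_prob01 s : 0 <= cmp_prob s <= 1.
Proof.
rewrite /cmp_prob; case: ifP => _; last by rewrite lexx ler01.
have h1 := w_gt0 s.1.1; have h2 := w_gt0 s.1.2.
rewrite ystarE divr_ge0 ?addr_ge0 ?(ltW h1) ?(ltW h2) //= ler_pdivrMr ?mul1r; lra.
Qed.

Lemma weightE (p : R) (om : Omega n L) :
  weight p w om = bern (edge_prob p) om.1 * bern cmp_prob om.2.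
Proof.
congr (_ * _); apply: eq_bigr => t _.
  by rewrite /edge_prob; case: ifP => _ //; rewrite subr0.
by rewrite /cmp_prob; case: ifP => _ //; rewrite subr0.
Qed.

Lemma adjE (om : Omega n L) i j : (adj om i j)%:R = adjw om.1 i j.
Proof.
by rewrite /adj /adjw; case: ltngtP => _ /=; rewrite ?orbF.
Qed.

Lemma yavgE (om : Omega n L) i j : yavg om i j = L%:R^-1 * \sum_l ycmp om i j l.
Proof. by rewrite /yavg INRE. Qed.

Lemma yavg_ge0 (om : Omega n L) i j : 0 <= yavg om i j.
Proof.
rewrite yavgE mulr_ge0 ?invr_ge0 ?ler0n //; apply: sumr_ge0 => l _.
by rewrite /ycmp; do 2 (case: ifP => _); rewrite ?lexx //; case: ifP => _; rewrite ?lexx ?ler01.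
Qed.

Lemma yavg_anti (om : Omega n L) i j : i != j -> yavg om i j + yavg om j i = 1.
Proof.
move=> ij; rewrite !yavgE -mulrDr -big_split /=.
rewrite (eq_bigr (fun _ => 1)) => [|l _].
  by rewrite sumr_const card_ord mulVf // pnatr_eq0 -lt0n.
rewrite /ycmp; move: ij; rewrite neq_ltn; case: ltngtP => // _ _.
  by case: ifP => _; rewrite ?addr0 ?add0r.
by case: ifP => _; rewrite ?addr0 ?add0r.
Qed.

Lemma yavg_centered (om : Omega n L) (i j : 'I_n) : (i < j)%N ->
  yavg om i j - ystar w i j = \sum_l L%:R^-1 * ((om.2 (i, j, l))%:R - cmp_prob (i, j, l)).
Proof.
move=> ij; rewrite -mulr_sumr sumrB mulrBr yavgE; congr (_ - _).
  by congr (_ * _); apply: eq_bigr => l _; rewrite /ycmp ij; case: (om.2 _).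
rewrite /cmp_prob /= ij sumr_const card_ord -[X in _ = _ * X]mulr_natl.
by rewrite mulKf // pnatr_eq0 -lt0n.
Qed.

(** An outcome enters the equations of its two endpoints with opposite signs, hence the difference
    of the values of [m]. *)
Definition lin_coef g (m : 'I_n -> R) (s : 'I_n * 'I_n * 'I_L) : R :=
  upper s.1 * (g s.1)%:R * ((m s.1.2 - m s.1.1) * (u s.1.1 + u s.1.2) * L%:R^-1).

(** Detailed balance: proportionality of [u] and [w] gives [(u_i + u_j) ystar_ij = u_j], so the mean
    flow across each edge is 0 and only centred outcomes remain. *)
Lemma defect_linear g Y (m : 'I_n -> R) :
  \sum_j m j * defect (adjw g) (yavg (g, Y)) u j =
  \sum_s lin_coef g m s * ((Y s)%:R - cmp_prob s).
Proof.
transitivity (\sum_j \sum_i adjw g j i *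
    (m j * (u i * yavg (g, Y) i j - u j * yavg (g, Y) j i))).
  apply: eq_bigr => j _; rewrite mulr_sumr; apply: eq_bigr => i _.
  by rewrite (adjw_sym g j); ring.
rewrite adjw_sum.
rewrite [RHS]sum_prod.
apply: eq_bigr => -[i j] _; rewrite /lin_coef /upper /=.
case: ltnP => ij; last by rewrite big1 ?mul0r // => l _; rewrite !mul0r.
have := yavg_centered (g, Y) ij; rewrite -mulr_sumr => e.
under eq_bigr do rewrite -!mulrA.
rewrite -!mulr_sumr -e -!mulrA; do 2 congr (_ * _).
have anti : yavg (g, Y) j i = 1 - yavg (g, Y) i j.
  have ne : i != j by rewrite neq_ltn ij.
  by have := yavg_anti (g, Y) ne; lra.
have yu : (u i + u j) * ystar w i j = u j.
  have h : w i + w j != 0 by rewrite gt_eqF // addr_gt0.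
  by rewrite ystarE mulrA mulrDl uw -mulrDr mulfK.
have -> : (u i + u j) * (yavg (g, Y) i j - ystar w i j) =
   (u i + u j) * yavg (g, Y) i j - u j by rewrite mulrBr yu.
by rewrite anti; ring.
Qed.

(** The constant 16 collects 2 from the centred Bernoulli bound, 2 from
    [(m_j - m_i)^2 <= 2 (m_i^2 + m_j^2)] and 4 from [(u_i + u_j)^2 <= 4 U^2]. The [L] outcomes of an
    edge, each of squared size [1 / L^2], give [1 / L]. *)
Lemma defect_mgf g (D : R) (m : 'I_n -> R) : (forall i, \sum_j adjw g i j <= D) ->
  \sum_Y bern cmp_prob Y * exp (\sum_j m j * defect (adjw g) (yavg (g, Y)) u j) <=
  exp (16 * U ^+ 2 * D / L%:R * \sum_j m j ^+ 2).
Proof.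
move=> hD; under eq_bigr do rewrite defect_linear.
apply: le_trans (bern_mgf_centered cmp_prob01 _) _; apply: ler_exp.
have LR : 0 < L%:R :> R by rewrite ltr0n.
pose F (i j : 'I_n) : R := m i ^+ 2.
have step : \sum_s lin_coef g m s ^+ 2 <=
    8 * U ^+ 2 / L%:R * \sum_i \sum_j adjw g i j * F i j.
  rewrite adjw_sum sum_prod mulr_sumr.
  apply: ler_sum => t _; rewrite /lin_coef /= sumr_const card_ord -[X in X <= _]mulr_natl.
  have -> : L%:R * (upper t * (g t)%:R * ((m t.2 - m t.1) * (u t.1 + u t.2) * L%:R^-1)) ^+ 2
     = (upper t * (g t)%:R) ^+ 2 / L%:R * ((m t.2 - m t.1) ^+ 2 * (u t.1 + u t.2) ^+ 2).
    by field; rewrite gt_eqF.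
  set a := upper t * (g t)%:R.
  have a2 : a ^+ 2 = a by rewrite /a /upper -natrM -natrX; case: ltnP => _; case: (g t).
  have a0 : 0 <= a by rewrite mulr_ge0 ?ler0n.
  have -> : 8 * U ^+ 2 / L%:R * (a * (F t.1 t.2 + F t.2 t.1)) =
      a ^+ 2 / L%:R * (2 * (F t.1 t.2 + F t.2 t.1) * (4 * U ^+ 2)) by rewrite a2; ring.
  apply: ler_wpM2l; first by rewrite divr_ge0 ?sqr_ge0 // ltW.
  have /andP[u1 u2] := u_bound t.1; have /andP[u3 u4] := u_bound t.2.
  have m2 : (m t.2 - m t.1) ^+ 2 <= 2 * (F t.1 t.2 + F t.2 t.1).
    by rewrite /F; have := sqr_ge0 (m t.2 + m t.1); nra.
  have u5 : (u t.1 + u t.2) ^+ 2 <= 4 * U ^+ 2.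
    set v := u t.1 + u t.2; have v0 : 0 <= v by rewrite addr_ge0.
    have v2 : v <= 2 * U by rewrite /v; lra.
    by nra.
  by apply: ler_pM; rewrite ?sqr_ge0.
have deg : \sum_i \sum_j adjw g i j * F i j <= D * \sum_j m j ^+ 2.
  rewrite mulr_sumr; apply: ler_sum => i _; rewrite -mulr_suml.
  by apply: ler_wpM2r; rewrite ?sqr_ge0.
have c0 : 0 <= 8 * U ^+ 2 / L%:R by apply: divr_ge0; [rewrite mulr_ge0 ?sqr_ge0 | exact: ltW].
have := le_trans step (ler_wpM2l c0 deg).
have -> : 16 * U ^+ 2 * D / L%:R * \sum_j m j ^+ 2 =
  2 * (8 * U ^+ 2 / L%:R * (D * \sum_j m j ^+ 2)) by ring.
by lra.
Qed.

End Comparisons.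

(** * Tail bounds and the functions dominating the failure event *)

Section Tails.
Local Open Scope ring_scope.

Variables (n L : nat) (p : R) (w u : 'I_n -> R) (U : R).
Implicit Types (g : {ffun 'I_n * 'I_n -> bool}) (Y : {ffun 'I_n * 'I_n * 'I_L -> bool}).

Hypothesis p01 : 0 <= p <= 1.
Hypothesis L_gt0 : (0 < L)%N.
Hypothesis w_gt0 : forall i, 0 < w i.
Hypothesis uw : forall i j, u i * w j = u j * w i.
Hypothesis u_bound : forall i, 0 <= u i <= U.

Definition expected_degree : R := n%:R * p.
Local Notation a := expected_degree.
Local Notation b g Y := (defect (adjw g) (@yavg n L (g, Y)) u).

Lemma degree_tail (k : 'I_n) :
  \sum_g bern (edge_prob p) g * exp (\sum_j adjw g k j - 3 * a) <= exp (- a).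
Proof.
under eq_bigr do rewrite expD mulrA.
rewrite -mulr_suml; apply: le_trans (ler_wpM2r (exp_ge0 _) (degree_mgf p01 k)) _.
by rewrite -expD; apply: ler_exp; rewrite -/a; lra.
Qed.

(** As [n - #|S|] is at least [n / 2], the moment bound gives exponent [- a #|S| / 4]; the threshold
    uses up half of it. *)
Lemma cut_tail (S : {set 'I_n}) : (2 * #|S| <= n)%N ->
  \sum_g bern (edge_prob p) g * exp (a / 8 * #|S|%:R - cut (adjw g) S) <=
  exp (- a / 8) ^+ #|S|.
Proof.
move=> hS.
under eq_bigr do rewrite addrC expD mulrA.
rewrite -mulr_suml; apply: le_trans (ler_wpM2r (exp_ge0 _) (cut_mgf p01 S)) _.
rewrite -expD expX; apply: ler_exp; rewrite -mulr_natr /a.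
have h : 2 * #|S|%:R <= n%:R :> R by rewrite -natrM ler_nat.
have s0 : 0 <= #|S|%:R :> R by rewrite ler0n.
have /andP[p0 _] := p01.
set s : R := #|S|%:R in h s0 *; set N : R := n%:R in h *.
have : 0 <= p * (s * (N - 2 * s)) by rewrite !mulr_ge0 // subr_ge0.
by lra.
Qed.

Lemma defect_tail g (D t s : R) (j : 'I_n) : (forall i, \sum_j adjw g i j <= D) ->
  \sum_Y bern (cmp_prob w) Y * exp (t * b g Y j - s) <=
  exp (16 * U ^+ 2 * D / L%:R * t ^+ 2 - s).
Proof.
move=> hD; under eq_bigr do rewrite expD mulrA.
rewrite -mulr_suml [leRHS]expD; apply: ler_wpM2r; first exact: exp_ge0.
pose m i := if i == j then t else 0.
have lin (F : 'I_n -> R) : \sum_i m i * F i = t * F j.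
  rewrite (bigD1 j) //= /m eqxx big1 ?addr0 // => i /negbTE ->.
  by rewrite mul0r.
have := defect_mgf L_gt0 w_gt0 uw u_bound m hD.
under eq_bigr do rewrite lin.
by under [X in _ <= exp (_ * X)]eq_bigr do rewrite expr2;
  rewrite lin /m eqxx -expr2.
Qed.

(** Scaling by [V^(-1/2)] brings the defects to the normalization of [exp_sq_moment]. Since
    [18 <= exp 5], the threshold [11 n] leaves [exp (- 6 n)], which is at most [n^-6]. *)
Lemma defect_norm_tail g (D V : R) : (forall i, \sum_j adjw g i j <= D) ->
  32 * U ^+ 2 * D / L%:R <= V -> 0 < V ->
  \sum_Y bern (cmp_prob w) Y * exp (4^-1 * V^-1 * (\sum_j b g Y j ^+ 2) - 11 * n%:R)
  <= exp (- 6 * n%:R).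
Proof.
move=> hD hV V0; under eq_bigr do rewrite expD mulrA.
rewrite -mulr_suml; pose r := Num.sqrt V^-1.
have r2 : r ^+ 2 = V^-1 by rewrite sqr_sqrtr // invr_ge0 ltW.
have h : \sum_Y bern (cmp_prob w) Y * exp (4^-1 * V^-1 * (\sum_j b g Y j ^+ 2)) <= 18 ^+ n.
  have -> : 18 ^+ n = 18 ^+ #|'I_n| :> R by rewrite card_ord.
  have := @exp_sq_moment _ _ (bern (cmp_prob w)) (fun Y j => r * b g Y j).
  move=> /(_ (bern_ge0 (cmp_prob01 w_gt0))) => H.
  apply: le_trans (H _) => [|m].
    rewrite le_eqVlt; apply/orP; left; apply/eqP; apply: eq_bigr => Y _.
    congr (_ * exp _); rewrite -mulrA mulr_sumr; congr (_ * _).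
    by apply: eq_bigr => j _; rewrite exprMn r2.
  have := defect_mgf L_gt0 w_gt0 uw u_bound (fun j => m j * r) hD.
  under eq_bigr do under eq_bigr do rewrite -mulrA.
  move=> h; apply: le_trans h _; apply: ler_exp.
  under eq_bigr do rewrite exprMn r2.
  rewrite -mulr_suml mulrA mulrAC; apply: ler_wpM2r; first by apply: sumr_ge0 => *; exact: sqr_ge0.
  rewrite -(ler_pM2r V0) divfK ?gt_eqF //; lra.
apply: le_trans (ler_wpM2r (exp_ge0 _) h) _.
have e18 : 18 <= exp 5.
  have -> : exp 5 = exp 1 ^+ 5 by rewrite expX.
  apply: (@le_trans _ _ (2 ^+ 5)); first by rewrite -natrX ler_nat.
  by rewrite lerXn2r ?nnegrE ?exp_ge0 //; have := le1D_exp 1; lra.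
apply: (@le_trans _ _ (exp 5 ^+ n * exp (- (11 * n%:R)))).
  apply: ler_wpM2r; first exact: exp_ge0.
  by rewrite lerXn2r ?nnegrE ?exp_ge0.
by rewrite expX -expD; apply: ler_exp; rewrite -mulr_natr; lra.
Qed.

Definition good_degree g := [forall k : 'I_n, \sum_j adjw g k j <= 3 * a].

(** Every violated bound contributes a term of at least 1, so a value below 1 certifies all the
    bounds at once. The empty set is excluded because its term would always be [exp 0 = 1]. *)
Definition graph_failure g : R :=
  \sum_(k < n) exp (\sum_j adjw g k j - 3 * a) +
  \sum_(S : {set 'I_n} | (0 < #|S|)%N && (2 * #|S| <= n)%N)
     exp (a / 8 * #|S|%:R - cut (adjw g) S).

(* The factor [good_degree g] makes the comparison terms integrable against the graph:
   the moment bounds hold conditionally on bounded degrees only. *)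
Definition cmp_failure (t beta V : R) g Y : R :=
  (good_degree g)%:R *
  (\sum_j (exp (t * b g Y j - t * beta) + exp (- t * b g Y j - t * beta)) +
   exp (4^-1 * V^-1 * (\sum_j b g Y j ^+ 2) - 11 * n%:R)).

Lemma graph_failure_ge0 g : 0 <= graph_failure g.
Proof. by apply: addr_ge0; apply: sumr_ge0 => *; exact: exp_ge0. Qed.

Lemma cmp_failure_ge0 t beta V g Y : 0 <= cmp_failure t beta V g Y.
Proof.
apply: mulr_ge0; first exact: ler0n.
by apply: addr_ge0; rewrite ?exp_ge0 //; apply: sumr_ge0 => *; rewrite addr_ge0 ?exp_ge0.
Qed.

Lemma graph_failure_mean (z : R) : exp (- a) <= z -> exp (- a / 8) <= z ->
  n%:R * z <= 2^-1 ->
  \sum_g bern (edge_prob p) g * graph_failure g <= 3 * (n%:R * z).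
Proof.
move=> z1 z2 nz.
have z0 : 0 <= z := le_trans (exp_ge0 _) z1.
under eq_bigr do rewrite mulrDr !mulr_sumr.
rewrite big_split /= exchange_big /= [X in _ + X]exchange_big /=.
have h1 : \sum_(k < n) \sum_g bern (edge_prob p) g * exp (\sum_j adjw g k j - 3 * a) <= n%:R * z.
  apply: (@le_trans _ _ (\sum_(k < n) z)); last by rewrite sumr_const card_ord mulr_natl.
  by apply: ler_sum => k _; exact: le_trans (degree_tail k) z1.
have h2 : \sum_(S : {set 'I_n} | (0 < #|S|)%N && (2 * #|S| <= n)%N) \sum_g
     bern (edge_prob p) g * exp (a / 8 * #|S|%:R - cut (adjw g) S) <= 2 * (n%:R * z).
  apply: (@le_trans _ _ (\sum_(S : {set 'I_n} | S != set0) z ^+ #|S|)).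
    rewrite big_mkcond [leRHS]big_mkcond; apply: ler_sum => S _ /=.
    rewrite card_gt0; case: (S != set0) => //=; case: ifP => hS; last exact: exprn_ge0.
    apply: le_trans (cut_tail hS) _; by rewrite lerXn2r ?nnegrE ?exp_ge0.
  (* Binomial expansion performs the union bound over all cuts: without the empty set the sum is
     [(1 + z)^n - 1], at most [2 n z] as long as [n z <= 1/2]. *)
  have total : \sum_(S : {set 'I_n}) z ^+ #|S| = (z + 1) ^+ n.
    rewrite -[X in _ ^+ X]card_ord -prodr_const bigA_distr.
    apply: eq_bigr => S _; rewrite -prodr_const big_mkcond.
    by apply: eq_bigr.
  have : (z + 1) ^+ n <= 1 + 2 * (n%:R * z).
    apply: (@le_trans _ _ (exp z ^+ n)).
      rewrite lerXn2r ?nnegrE ?exp_ge0 ?addr_ge0 //.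
      by rewrite addrC le1D_exp.
    rewrite expX -mulr_natl.
    apply: le_trans (exp_le_inv _) _; first lra.
    have nz0 : 0 <= n%:R * z by rewrite mulr_ge0 ?ler0n.
    rewrite -[_^-1]mul1r ler_pdivrMr; first by nra.
    by lra.
  by rewrite -total (bigD1 set0) //= cards0 expr0 lerD2l.
lra.
Qed.

(** With the degree bound [D = 3 a], the constants 16 and 32 of the two tail bounds become 48 and
    96. *)
Lemma cmp_failure_mean (t beta V z : R) g : 0 < a -> 96 * U ^+ 2 * a / L%:R <= V -> 0 < V ->
  exp (48 * U ^+ 2 * a / L%:R * t ^+ 2 - t * beta) <= z -> exp (- 6 * n%:R) <= z ->
  \sum_Y bern (cmp_prob w) Y * cmp_failure t beta V g Y <= (2 * n%:R + 1) * z.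
Proof.
move=> a0 hV V0 z1 z2.
have z0 : 0 <= z := le_trans (exp_ge0 _) z1.
rewrite /cmp_failure; have [/forallP hg|_] := boolP (good_degree g); last first.
  rewrite big1 => [|Y _]; last by rewrite mul0r mulr0.
  by rewrite mulr_ge0 // addr_ge0 // mulr_ge0.
under eq_bigr do rewrite mul1r mulrDr mulr_sumr.
rewrite big_split /= exchange_big /= [leRHS]mulrDl mul1r; apply: lerD; last first.
  apply: le_trans z2; apply: defect_norm_tail hg _ V0.
  apply: le_trans hV; rewrite le_eqVlt; apply/orP; left; apply/eqP; ring.
apply: (@le_trans _ _ (\sum_(j < n) 2 * z)); last first.
  by rewrite sumr_const card_ord -mulr_natl; lra.
apply: ler_sum => j _; under eq_bigr do rewrite mulrDr.
rewrite big_split /=.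
have e (s : R) : 16 * U ^+ 2 * (3 * a) / L%:R * s ^+ 2 = 48 * U ^+ 2 * a / L%:R * s ^+ 2.
  by ring.
have t1 := defect_tail t (t * beta) j hg.
have t2 := defect_tail (- t) (t * beta) j hg.
rewrite e in t1; rewrite e sqrrN in t2; lra.
Qed.

Lemma no_failure (t beta V : R) g Y : 0 < t -> 0 < V ->
  graph_failure g + cmp_failure t beta V g Y < 1 ->
  [/\ forall i, \sum_j adjw g i j <= 3 * a,
      forall S : {set 'I_n}, (2 * #|S| <= n)%N -> a / 8 * #|S|%:R <= cut (adjw g) S,
      forall j, `|b g Y j| <= beta &
      \sum_j b g Y j ^+ 2 <= 44 * n%:R * V].
Proof.
move=> t0 V0 hlt.
have gf := graph_failure_ge0 g; have cf := cmp_failure_ge0 t beta V g Y.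
set F1 := \sum_(k < n) exp (\sum_j adjw g k j - 3 * a).
set F2 := \sum_(S : {set 'I_n} | (0 < #|S|)%N && (2 * #|S| <= n)%N)
     exp (a / 8 * #|S|%:R - cut (adjw g) S).
have F10 : 0 <= F1 by apply: sumr_ge0 => *; exact: exp_ge0.
have F20 : 0 <= F2 by apply: sumr_ge0 => *; exact: exp_ge0.
have gfE : graph_failure g = F1 + F2 by [].
have hdeg i : \sum_j adjw g i j <= 3 * a.
  have h := @ler_sum_term _ _ predT (fun k => exp (\sum_j adjw g k j - 3 * a)) i
    (fun k => exp_ge0 _) isT.
  have : exp (\sum_j adjw g i j - 3 * a) < 1.
    by apply: le_lt_trans h _; rewrite -/F1; lra.
  by move=> /exp_lt1; lra.
(* The degree bounds come first: they set the factor in [cmp_failure] to 1 and so make its terms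
   available. *)
have gd : good_degree g by apply/forallP.
move: cf hlt; rewrite /cmp_failure gd mul1r.
set F3 := \sum_j _; set F4 := exp _ => cf hlt.
have F30 : 0 <= F3 by apply: sumr_ge0 => *; rewrite addr_ge0 ?exp_ge0.
have F40 : 0 <= F4 by exact: exp_ge0.
split=> //.
- move=> S hS; have [->|S0] := eqVneq S set0.
    rewrite cards0 mulr0; apply: sumr_ge0 => i _; apply: sumr_ge0 => j _.
    by rewrite mulr_ge0 ?adjw_ge0 // mulr_ge0 ?ler0n.
  have h := @ler_sum_term _ _ (fun S : {set 'I_n} => (0 < #|S|)%N && (2 * #|S| <= n)%N)
    (fun S => exp (a / 8 * #|S|%:R - cut (adjw g) S)) S (fun S => exp_ge0 _).
  rewrite card_gt0 S0 hS in h; have {}h := h isT.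
  have : exp (a / 8 * #|S|%:R - cut (adjw g) S) < 1.
    by apply: le_lt_trans h _; rewrite -/F2; lra.
  by move=> /exp_lt1; lra.
- move=> j.
  have h := @ler_sum_term _ _ predT (fun j => exp (t * b g Y j - t * beta)
       + exp (- t * b g Y j - t * beta)) j (fun j => addr_ge0 (exp_ge0 _) (exp_ge0 _)) isT.
  rewrite -/F3 in h.
  have e1 := exp_ge0 (t * b g Y j - t * beta).
  have e2 := exp_ge0 (- t * b g Y j - t * beta).
  have /exp_lt1 l1 : exp (t * b g Y j - t * beta) < 1 by lra.
  have /exp_lt1 l2 : exp (- t * b g Y j - t * beta) < 1 by lra.
  rewrite ler_norml; apply/andP; split; rewrite -(ler_pM2l t0); lra.
- have /exp_lt1 l4 : F4 < 1 by lra.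
  rewrite -(ler_pM2l (_ : 0 < 4^-1 * V^-1)); last by rewrite mulr_gt0 ?invr_gt0.
  have -> : 4^-1 * V^-1 * (44 * n%:R * V) = 11 * n%:R by field; rewrite gt_eqF.
  lra.
Qed.

End Tails.

(** * From pointwise domination to probability, and from stationarity to balance *)

Section Reduction.
Local Open Scope ring_scope.

(** Markov's inequality: the indicator of [E] is at least [1 - (fg + fc)]. The comparisons are
    averaged first with the graph fixed, hence the bound on [fc] uniform in [g]. *)
Lemma Prob_ge (n L : nat) (p : R) (w : 'I_n -> R) (E : Omega n L -> Prop)
    (fg : {ffun 'I_n * 'I_n -> bool} -> R)
    (fc : {ffun 'I_n * 'I_n -> bool} -> {ffun 'I_n * 'I_n * 'I_L -> bool} -> R)
    (eg ec : R) :
  0 <= p <= 1 -> (forall i, 0 < w i) ->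
  (forall g, 0 <= fg g) -> (forall g Y, 0 <= fc g Y) ->
  (forall g Y, fg g + fc g Y < 1 -> E (g, Y)) ->
  \sum_g bern (edge_prob p) g * fg g <= eg ->
  (forall g, \sum_Y bern (cmp_prob w) Y * fc g Y <= ec) ->
  1 - (eg + ec) <= Prob p w E.
Proof.
move=> p01 w0 fg0 fc0 hE hg hc.
have g0 (g : {ffun 'I_n * 'I_n -> bool}) : 0 <= bern (edge_prob p) g.
  exact: bern_ge0 (edge_prob01 p01) g.
have Y0 (Y : {ffun 'I_n * 'I_n * 'I_L -> bool}) : 0 <= bern (cmp_prob w) Y.
  exact: bern_ge0 (cmp_prob01 w0) Y.
pose W (om : Omega n L) := bern (edge_prob p) om.1 * bern (cmp_prob w) om.2.
apply: (@le_trans _ _ (\sum_om W om * (1 - (fg om.1 + fc om.1 om.2)))); last first.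
  rewrite /Prob /rsum; apply: ler_sum => -[g Y] _; rewrite weightE -/(W (g, Y)).
  apply: ler_wpM2l; first exact: mulr_ge0.
  rewrite /Defs.ind /=;
    case: (ClassicalDescription.excluded_middle_informative (E (g, Y))) => [HE|nE].
    by change (1 - (fg g + fc g Y) <= 1); have := fg0 g; have := fc0 g Y; lra.
  change (1 - (fg g + fc g Y) <= 0); rewrite subr_le0 leNgt.
  by apply/negP => /hE; exact: nE.
rewrite sum_prod.
have -> : \sum_i \sum_j W (i, j) * (1 - (fg (i, j).1 + fc (i, j).1 (i, j).2)) =
   1 - (\sum_g bern (edge_prob p) g * fg g +
        \sum_g bern (edge_prob p) g * \sum_Y bern (cmp_prob w) Y * fc g Y).
  transitivity (\sum_g (bern (edge_prob p) g - (bern (edge_prob p) g * fg g +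
      bern (edge_prob p) g * \sum_Y bern (cmp_prob w) Y * fc g Y))); last first.
    by rewrite sumrB bern_sum1 big_split.
  apply: eq_bigr => g _; rewrite /W /= mulr_sumr.
  transitivity (\sum_Y (bern (edge_prob p) g * (1 - fg g) * bern (cmp_prob w) Y
      - bern (edge_prob p) g * (bern (cmp_prob w) Y * fc g Y))).
    by apply: eq_bigr => Y _; ring.
  by rewrite sumrB -!mulr_sumr bern_sum1; ring.
rewrite lerD2l lerN2; apply: lerD => //.
apply: (@le_trans _ _ (\sum_g bern (edge_prob p) g * ec)).
  by apply: ler_sum => g _; apply: ler_wpM2l.
by rewrite -mulr_suml bern_sum1 mul1r.
Qed.

(** The diagonal entry of [Pmat] carries the outflow, so the [j]-th equation says that the defect
    divided by [d] is 0. *)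
Lemma stationary_defect (n L : nat) (om : Omega n L) (d : R) (pi : 'I_n -> R) j :
  0 < d -> stationary om d pi -> defect (adjw om.1) (yavg om) pi j = 0.
Proof.
move=> d0 [/(_ j) H _]; move: H; rewrite /rsum.
pose f i := adjw om.1 i j * (pi i * yavg om i j).
have jj : adjw om.1 j j = 0 by rewrite /adjw ltnn.
have -> : \big[Rplus/R0]_i (Rmult (pi i) (Pmat om d i j)) =
    pi j - d^-1 * (\sum_i adjw om.1 i j * (pi j * yavg om j i)) + d^-1 * \sum_i f i.
  transitivity (\sum_i pi i * Pmat om d i j); first by [].
  rewrite (bigD1 j) //=; congr (_ + _).
    rewrite /Pmat eqxx /rsum big_mkcond /=.
    transitivity (pi j * (1 - d^-1 * \sum_i (if adj om j i then yavg om j i else 0))); first by [].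
    rewrite mulrBr mulr1 mulrCA mulr_sumr; congr (_ - _ * _).
    apply: eq_bigr => i _; rewrite adjw_sym -adjE.
    by case: (adj om j i); rewrite ?mul1r ?mul0r ?mulr0.
  rewrite [in RHS](bigD1 j) //= /f jj mul0r add0r mulr_sumr; apply: eq_bigr => i ij.
  rewrite /Pmat (negbTE ij) -adjE; case: (adj om i j); rewrite ?mul1r ?mul0r ?mulr0 //.
  by rewrite mulrCA.
move=> H.
have {}H : d^-1 * (\sum_i f i - \sum_i adjw om.1 i j * (pi j * yavg om j i)) = 0 by lra.
have e : defect (adjw om.1) (yavg om) pi j =
    \sum_i f i - \sum_i adjw om.1 i j * (pi j * yavg om j i).
  by rewrite -sumrB; apply: eq_bigr => i _; rewrite /f mulrBr.
move/eqP: H; rewrite e mulf_eq0 invr_eq0 gt_eqF //= => /eqP; exact.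
Qed.

End Reduction.

Section Event.
Local Open Scope R_scope.

Definition close_event (n L : nat) (p d : R) (w : 'I_n -> R) (C : R) (om : Omega n L) : Prop :=
  forall pi : 'I_n -> R, stationary om d pi ->
    norm2 (fun i => pi i - pistar w i) / norm2 (pistar w) <= C / sqrt (INR n * p * INR L).

End Event.

(** * Error bound on the good event and choice of constants *)

Section Conclusion.
Local Open Scope ring_scope.

Lemma norm2E n (v : 'I_n -> R) : norm2 v = Num.sqrt (\sum_i v i ^+ 2).
Proof.
rewrite /norm2 RsqrtE; congr Num.sqrt.
by apply: eq_bigr => i _; rewrite RpowE.
Qed.

Lemma relative_error_le (n L : nat) (om : Omega n L) (p d k m : R) (u pi : 'I_n -> R) :
  (0 < n)%N -> (0 < L)%N -> 0 < p -> 1 <= k -> 0 < m -> 0 < d ->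
  (forall i, m <= u i <= k * m) -> \sum_i u i = 1 ->
  (forall i, \sum_j adjw om.1 i j <= 3 * (n%:R * p)) ->
  (forall S : {set 'I_n}, (2 * #|S| <= n)%N -> n%:R * p / 8 * #|S|%:R <= cut (adjw om.1) S) ->
  (forall j, `|defect (adjw om.1) (yavg om) u j| <= m * (n%:R * p) / (768 * k)) ->
  \sum_j defect (adjw om.1) (yavg om) u j ^+ 2 <=
    44 * n%:R * (96 * (k * m) ^+ 2 * (n%:R * p) / L%:R) ->
  stationary om d pi ->
  \sum_i (pi i - u i) ^+ 2 <=
    64 * 192 ^+ 2 * 44 * 96 * k ^+ 6 / (n%:R * p * L%:R) * \sum_i u i ^+ 2.
Proof.
move=> n0 L0 p0 k1 m0 d0 hu su hdeg hcut hb1 hb2 hst.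
have nR : 0 < n%:R :> R by rewrite ltr0n.
have LR : 0 < L%:R :> R by rewrite ltr0n.
set a := n%:R * p in hdeg hcut hb1 hb2 *.
have a0 : 0 < a by rewrite mulr_gt0.
have k0 : 0 < k by lra.
have anti i j : adjw om.1 i j * (yavg om i j + yavg om j i) = adjw om.1 i j.
  have [->|ij] := eqVneq i j; first by rewrite /adjw ltnn mul0r.
  by rewrite yavg_anti // mulr1.
(* Cheeger with expansion [a / 8] and degree [3 a] gives [(a / 8)^2 / (3 a) = a / 192]; the
   stability threshold [m lam / (4 k)] is then [m a / (768 k)]. *)
have gap (f : 'I_n -> R) : exists c, a / 192 * \sum_i (f i - c) ^+ 2 <=
     \sum_i \sum_j adjw om.1 i j * (f i - f j) ^+ 2.
  have [||S hS||c hc] := @cheeger _ _ _ (adjw_ge0 om.1) (adjw_sym om.1) (a / 8) (3 * a) f.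
  - by rewrite divr_gt0.
  - by rewrite mulr_gt0.
  - by apply: hcut; rewrite card_ord in hS.
  - exact: hdeg.
  - exists c; apply: le_trans hc; rewrite le_eqVlt; apply/orP; left; apply/eqP.
    by congr (_ * _); field; rewrite gt_eqF.
have spi : \sum_i pi i = \sum_i u i by rewrite su; case: hst.
have lam0 : 0 < a / 192 by rewrite divr_gt0.
have := stationary_stability (adjw_ge0 om.1) (adjw_sym om.1) (yavg_ge0 om) anti
  m0 k1 lam0 hu (fun j => stationary_defect j d0 hst) spi gap.
have hb1' j : `|defect (adjw om.1) (yavg om) u j| <= m * (a / 192) / (4 * k).
  apply: le_trans (hb1 j) _; rewrite le_eqVlt; apply/orP; left; apply/eqP.
  by field; rewrite gt_eqF.
move=> /(_ hb1') h; apply: le_trans h _.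
have c0 : 0 <= 64 * k ^+ 4 / (a / 192) ^+ 2.
  by apply: divr_ge0; rewrite ?sqr_ge0 // mulr_ge0 // exprn_ge0 // ltW.
apply: le_trans (ler_wpM2l c0 hb2) _.
have um : n%:R * m ^+ 2 <= \sum_i u i ^+ 2.
  rewrite -[X in X%:R]card_ord mulr_natl -sumr_const; apply: ler_sum => i _.
  by have /andP[h _] := hu i; nra.
have c1 : 0 <= 64 * 192 ^+ 2 * 44 * 96 * k ^+ 6 / (a * L%:R).
  apply: divr_ge0; last by rewrite mulr_ge0 // ltW.
  by apply: mulr_ge0; [lra | rewrite exprn_ge0 // ltW].
apply: le_trans (ler_wpM2l c1 um); rewrite le_eqVlt; apply/orP; left; apply/eqP.
by field; rewrite !gt_eqF.
Qed.

(* Where [192 * 768^2 k^4] comes from: with the optimal tilt [t], each tail of a single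
   defect is [exp (- n p / (192 * 768^2 k^4))], which has to be at most [n^-6]. *)
Lemma btl_bound (n L : nat) (p d wmin wmax k : R) (w : 'I_n -> R) :
  (1 < n)%N -> (0 < L)%N -> 0 < p -> p <= 1 -> 1 <= k -> 0 < d -> 0 < wmin ->
  (forall i, wmin <= w i <= wmax) -> wmax <= k * wmin ->
  6 * (192 * 768 ^+ 2) * k ^+ 4 * ln n%:R <= n%:R * p ->
  1 - 6 / n%:R ^+ 5 <=
    Prob p w (@close_event n L p d w (Num.sqrt (64 * 192 ^+ 2 * 44 * 96 * k ^+ 6))).
Proof.
move=> n1 L0 p0 p1 k1 d0 wmin0 hw hk hln.
have n0 : (0 < n)%N by exact: ltnW.
have nR : 2 <= n%:R :> R by rewrite ler_nat.
have LR : 1 <= L%:R :> R by rewrite ler1n.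
have w0 i : 0 < w i by have /andP[h _] := hw i; exact: lt_le_trans h.
set Z := \sum_i w i.
have Z0 : 0 < Z.
  apply: (@lt_le_trans _ _ (n%:R * wmin)); first by rewrite mulr_gt0 //; lra.
  rewrite -[X in X%:R]card_ord mulr_natl -sumr_const; apply: ler_sum => i _.
  by have /andP[] := hw i.
pose u := pistar w; pose m := wmin / Z.
have uE i : u i = w i / Z by [].
have m0 : 0 < m by rewrite divr_gt0.
have hu i : m <= u i <= k * m.
  have /andP[h1 h2] := hw i; rewrite uE /m mulrA !ler_pM2r ?invr_gt0 // h1 /=.
  exact: le_trans h2 hk.
have su : \sum_i u i = 1.
  by under eq_bigr do rewrite uE; rewrite -mulr_suml mulfV // gt_eqF.
have u_bound i : 0 <= u i <= k * m.
  by have /andP[h1 ->] := hu i; rewrite andbT; apply: le_trans h1; exact: ltW.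
have uw i j : u i * w j = u j * w i by rewrite !uE; ring.
have p01 : 0 <= p <= 1 by rewrite ltW.
pose a := n%:R * p.
have a0 : 0 < a by rewrite mulr_gt0 //; lra.
have k0 : 0 < k by lra.
have k4 : 1 <= k ^+ 4 by rewrite exprn_ege1.
have /andP[ln0 lnn] := ln_bounds n0.
have k4ln : ln n%:R <= k ^+ 4 * ln n%:R by rewrite ler_peMl.
have nR0 : 0 < n%:R :> R by lra.
pose z : R := (n%:R ^+ 6)^-1.
have nz : n%:R * z = (n%:R ^+ 5)^-1.
  by rewrite /z; field; rewrite gt_eqF.
have z0 : 0 <= z by rewrite invr_ge0 exprn_ge0 // ltW.
have z1 : exp (- a) <= z by apply: exp_neg_le => //; rewrite /a; lra.
have z2 : exp (- a / 8) <= z.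
  by rewrite mulNr; apply: exp_neg_le => //; rewrite /a; lra.
have z3 : exp (- 6 * n%:R) <= z.
  by rewrite mulNr; apply: exp_neg_le => //; lra.
(* [beta] is the defect size tolerated by [relative_error_le], and [V] the smallest scale allowed by
   [cmp_failure_mean] with [U = k m]. *)
pose beta := m * a / (768 * k); pose V := 96 * (k * m) ^+ 2 * a / L%:R.
(* Minimizer of [48 (k m)^2 a t^2 - t beta], the tail exponent once [1 / L] is bounded by 1. *)
pose t := beta / (96 * (k * m) ^+ 2 * a).
have beta0 : 0 < beta by apply: divr_gt0; apply: mulr_gt0.
have q0 : 0 < 96 * (k * m) ^+ 2 * a.
  by apply: mulr_gt0 => //; apply: mulr_gt0 => //; apply: exprn_gt0; exact: mulr_gt0.
have t0 : 0 < t by exact: divr_gt0.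
have V0 : 0 < V by apply: divr_gt0 => //; lra.
have z4 : exp (48 * (k * m) ^+ 2 * a / L%:R * t ^+ 2 - t * beta) <= z.
  apply: (@le_trans _ _ (exp (- (a / (192 * 768 ^+ 2 * k ^+ 4))))); last first.
    apply: exp_neg_le => //; rewrite ler_pdivlMr; last by lra.
    by rewrite /a; lra.
  apply: ler_exp.
  apply: (@le_trans _ _ (48 * (k * m) ^+ 2 * a * t ^+ 2 - t * beta)).
    rewrite lerD2r; apply: ler_wpM2r; first exact: sqr_ge0.
    rewrite ler_pdivrMr; last lra.
    rewrite ler_peMr // mulr_ge0 ?(ltW a0) // mulr_ge0 // sqr_ge0 //.
  rewrite le_eqVlt; apply/orP; left; apply/eqP; rewrite /t /beta.
  by field; rewrite !gt_eqF.
have nz2 : n%:R * z <= 2^-1.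
  rewrite nz lef_pV2 ?posrE ?exprn_gt0 //.
  by apply: le_trans nR _; apply: ler_eXnr => //; rewrite ler1n.
have hg := graph_failure_mean p01 z1 z2 nz2.
have hc g := @cmp_failure_mean n L p w u (k * m) L0 w0 uw u_bound t beta V z g a0 (lexx _) V0 z4 z3.
(* The total failure mass is [(5 n + 1) z], at most [6 n z = 6 / n^5]. *)
apply: (@le_trans _ _ (1 - (3 * (n%:R * z) + (2 * n%:R + 1) * z))).
  rewrite lerD2l lerN2 -nz; nra.
apply: (Prob_ge p01 w0 _ _ _ hg hc) => [g|g Y|g Y].
- exact: graph_failure_ge0.
- exact: cmp_failure_ge0.
move=> /(no_failure t0 V0)[hdeg hcut hb1 hb2] pi hst.
have := @relative_error_le n L (g, Y) p d k m u pi n0 L0 p0 k1 m0 d0 hu su hdeg hcut hb1 hb2 hst.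
set Cq := 64 * 192 ^+ 2 * 44 * 96 * k ^+ 6 => hmain.
have Cq0 : 0 <= Cq.
  by rewrite /Cq; apply: mulr_ge0; [lra | rewrite exprn_ge0 // ltW].
apply/RleP; rewrite !RdivE RsqrtE !INRE !norm2E.
have um : 0 < \sum_i u i ^+ 2.
  apply: (@lt_le_trans _ _ (n%:R * m ^+ 2)); first by rewrite mulr_gt0 // exprn_gt0.
  rewrite -[X in X%:R]card_ord mulr_natl -sumr_const; apply: ler_sum => i _.
  by have /andP[h _] := hu i; nra.
have aL : 0 <= n%:R * p * L%:R by rewrite !mulr_ge0 ?ler0n // ltW.
rewrite ler_pdivrMr ?sqrtr_gt0 // -sqrtrV // -sqrtrM // -sqrtrM; last first.
  by rewrite mulr_ge0 // invr_ge0.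
exact: ler_wsqrtr.
Qed.

End Conclusion.

Open Scope R_scope.

Theorem theorem9 :
  forall (kappa0 c_d : R), 1 <= kappa0 -> 2 <= c_d ->
  exists (c0 C C' : R), 0 < c0 /\ 0 < C /\ 0 < C' /\
  forall (n L : nat) (p d wmin wmax : R) (w : 'I_n -> R),
    (1 <= L)%N ->
    0 < p -> p <= 1 ->
    0 < wmin ->
    (forall i, wmin <= w i <= wmax) ->
    (forall i j : 'I_n, (i <= j)%N -> w j <= w i) ->
    wmax / wmin <= kappa0 ->
    c0 * ln (INR n) / INR n <= p ->
    c_d * INR n * p <= d ->
    @Prob n L p w (fun om =>
      forall pi : 'I_n -> R, stationary om d pi ->
        norm2 (fun i => pi i - pistar w i) / norm2 (pistar w)
          <= C / sqrt (INR n * p * INR L))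
      >= 1 - C' / INR n ^ 5.
Proof.
move=> k cd /RleP k1 cd2.
have cd0 : (0 < cd)%R by apply/RltP; exact: Rlt_le_trans Rlt_0_2 cd2.
exists (6 * (192 * 768 ^+ 2) * k ^+ 4)%R, (Num.sqrt (64 * 192 ^+ 2 * 44 * 96 * k ^+ 6))%R, 6%:R%R.
have k0 : (0 < k)%R by apply: lt_le_trans k1; exact: ltr01.
split; first by apply/RltP; apply: mulr_gt0; [lra | exact: exprn_gt0].
split; first by apply/RltP; rewrite sqrtr_gt0; apply: mulr_gt0; [lra | exact: exprn_gt0].
split; first by apply/RltP; rewrite ltr0n.
move=> n L p d wmin wmax w L0 /RltP p0 /RleP p1 /RltP wmin0 hw _ /RleP hk /RleP hc0 /RleP hd.
have hw' i : (wmin <= w i <= wmax)%R by have [/RleP -> /RleP ->] := hw i.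
have w0 i : (0 < w i)%R by have /andP[h _] := hw' i; exact: lt_le_trans h.
have p01 : (0 <= p <= 1)%R by rewrite (ltW p0).
have -> : 1 - 6%:R%R / INR n ^ 5 = (1 - 6 / n%:R ^+ 5)%R by rewrite RpowE INRE RdivE.
apply: Rle_ge; apply/RleP.
change (1 - 6 / n%:R ^+ 5 <= Prob p w
  (@close_event n L p d w (Num.sqrt (64 * 192 ^+ 2 * 44 * 96 * k ^+ 6))))%R.
have [n2|] := ltnP 1 n.
  have nR : (0 < n%:R :> R)%R by rewrite ltr0n ltnW.
  apply: (@btl_bound n L p d wmin wmax k w) => //.
  - apply: lt_le_trans hd; rewrite INRE.
    by apply: mulr_gt0 => //; exact: mulr_gt0.
  - by move: hk; rewrite RdivE ler_pdivrMr.
  - by move: hc0; rewrite INRE RdivE ler_pdivrMr // [(p * _)%R]mulrC.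
(* For [n = 0] the quotient by [0 ^ 5] is 0, so probability 1 is claimed; it holds because an empty
   sum is never 1 and nothing is stationary. *)
case: n w hw hw' w0 hc0 hd => [|[|//]] w hw hw' w0 _ _ _.
  apply: (@le_trans _ _ (1 - (0 + 0))%R).
    by rewrite expr0n invr0 mulr0 addr0.
  apply: (@Prob_ge _ _ _ _ _ (fun=> 0%R) (fun _ _ => 0%R)) => // [g Y _ pi [_]||g].
  - by rewrite /rsum big_ord0 => /esym /eqP; rewrite (negbTE (oner_neq0 R)).
  - by rewrite big1 // => g _; rewrite mulr0.
  - by rewrite big1 // => Y _; rewrite mulr0.
(* For [n = 1] the claimed lower bound is negative; the constant failure function 1 makes the
   domination vacuous. *)
apply: (@le_trans _ _ (1 - (1 + 0))%R).
  by rewrite expr1n divr1 addr0 lerD2l lerN2 ler1n.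
apply: (@Prob_ge _ _ _ _ _ (fun=> 1%R) (fun _ _ => 0%R)) => // [g Y||g].
- by rewrite addr0 ltxx.
- by under eq_bigr do rewrite mulr1; rewrite bern_sum1.
- by rewrite big1 // => Y _; rewrite mulr0.
Qed.
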